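(* Consider the JSQ systems described in the context, in which each server has a finite buffer of length $b$, and suppose the rate assumption holds. Let $\varepsilon>0$ and assume there exists $\varrho>0$ such that $\mathbb P(\varsigma^n+\nu^n>\varepsilon)>\varrho$ for all $n\in\mathbb N$. Then there exist constants $C_{1,\varepsilon},C_{2,\varepsilon},C_{3,\varepsilon}$, uniform in $n$ and over all tie-breaking policies $\pi$ for which a stationary version exists, such that for all $n\in\mathbb N$ $$\mathbb E\big[|X_1^{\pi,n}(\infty)|\,\big|\,\varsigma^n+\nu^n>\varepsilon\big]<C_{1,\varepsilon},\quad \mathbb E\big[|X_2^{\pi,n}(\infty)|\,\big|\,\varsigma^n+\nu^n>\varepsilon\big]<C_{2,\varepsilon},\quad \mathbb E\big[|X_3^{\pi,n}(\infty)|\,\big|\,\varsigma^n+\nu^n>\varepsilon\big]<C_{3,\varepsilon}\,n^{-1/2}.$$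
   Context: **Model.** $S=[\mu_{\min},\mu_{\max}]$ with $0<\mu_{\min}\le1\le\mu_{\max}<\infty$, $\mu_{\min}<\mu_{\max}$. The $n$th system has $n$ servers, each serving its own queue in FCFS order. Jobs arrive according to a Poisson process of rate $n\lambda^n$. Service times at server $k$ are i.i.d. exponential with rate $\mu_k^n\in S$; the vector $\boldsymbol\mu^n=(\mu_k^n)_k$ may be random, is known at time $0$ and constant in time. Each arriving job is immediately routed to a server with the fewest jobs (JSQ), ties being broken by the rule $\pi$. Each server can hold at most $b$ jobs (including the one in service), $b\in\mathbb N$ fixed; a job arriving when all servers hold $b$ jobs is rejected. $Q_i^{\pi,n}(t)$ is the number of servers with at least $i$ jobs at time $t$; $X_1^{\pi,n}=n^{-1/2}(Q_1^{\pi,n}-n)$ and $X_i^{\pi,n}=n^{-1/2}Q_i^{\pi,n}$ for $i\ge2$. $X_i^{\pi,n}(\infty)$ denotes a random variable with the stationary law: conditionally on $\boldsymbol\mu^n$ with $\varsigma^n+\nu^n>\varepsilon$ it has the stationary distribution of the system with that rate vector, and this is then averaged over the conditional law of $\boldsymbol\mu^n$. **Rate assumption.** Let $F_n(\mu)=n^{-1}\sum_k\mathbf 1(\mu_k^n\le\mu)$ and $\bar\mu^n=n^{-1}\sum_k\mu_k^n$. There are a probability measure $F$ with support $S$ (meaning $S$ is the smallest closed interval containing the support of $F$), mean $1$ and variance $\sigma_F^2$, and a random variable $\nu$ with finite mean and variance, such that $F_n\Rightarrow F$ (convergence in distribution/weakly), $\nu^n:=n^{1/2}(\bar\mu^n-1)\Rightarrow\nu$,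 $\mathbb E|\nu^n|\to\mathbb E|\nu|$; and $\varsigma^n:=n^{1/2}(1-\lambda^n)\to\varsigma>0$ deterministically. *)

(* Defs.v *)
From HB Require Import structures.
From mathcomp Require Export all_boot all_order all_algebra.
From mathcomp Require Export all_classical all_reals all_analysis.

Set Implicit Arguments.
Unset Strict Implicit.
Unset Printing Implicit Defensive.

Import Order.TTheory GRing.Theory Num.Theory.
Import numFieldNormedType.Exports.

Local Open Scope classical_set_scope.
Local Open Scope ring_scope.

Section convergence.
Context {R : realType}.

Definition cvg_in_distribution (d : nat -> measure_display)
    (Om : forall n, measurableType (d n)) (P : forall n, probability (Om n) R)
    (X : forall n, Om n -> R)
    (d' : measure_display) (Om' : measurableType d') (P' : probability Om' R)
    (Y : Om' -> R) : Prop :=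
  forall f : R -> R, continuous f -> (exists M, forall x, `|f x| <= M) ->
    'E_(P n)[f \o X n]%E @[n --> \oo] --> 'E_P'[f \o Y]%E.

Definition cvg_in_probability (d : nat -> measure_display)
    (Om : forall n, measurableType (d n)) (P : forall n, probability (Om n) R)
    (X : forall n, Om n -> R) (c : R) : Prop :=
  forall e : R, 0 < e -> P n [set w | e < `|X n w - c|] @[n --> \oo] --> 0%E.

Definition empirical_cdf (n : nat) (m : 'I_n -> R) (x : R) : R :=
  n%:R^-1 * #|[pred k : 'I_n | m k <= x]|%:R.

(* Weak convergence of the random distribution functions of the vectors [m n]
   to a deterministic law: convergence in distribution to a constant is
   convergence in probability, required at every continuity point of the limit
   distribution function. *)
Definition empirical_weak_cvg (d : nat -> measure_display)
    (Om : forall n, measurableType (d n)) (P : forall n, probability (Om n) R)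
    (m : forall n, Om n -> 'I_n -> R)
    (F : probability (measurableTypeR R) R) : Prop :=
  forall x : R, {for x, continuous (fun y : R => fine (F `]-oo, y]%classic))} ->
    cvg_in_probability P (fun n w => empirical_cdf (m n w) x)
      (fine (F `]-oo, x]%classic)).

Definition law_support (F : probability (measurableTypeR R) R) : set R :=
  [set x | forall e : R, 0 < e -> (0 < F (ball x e))%E].

Definition smallest_closed_interval (A : set R) (a b : R) : Prop :=
  A `<=` `[a, b]%classic /\
  forall a' b' : R, A `<=` `[a', b']%classic -> `[a, b]%classic `<=` `[a', b']%classic.

Definition cond_expectation (d : measure_display) (T : measurableType d)
    (P : probability T R) (A : set T) (f : T -> R) : \bar R :=
  ((fine (P A))^-1%:E * \int[P]_(w in A) (f w)%:E)%E.

End convergence.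

Section driving_processes.
Context {R : realType} (d : measure_display) (T : measurableType d)
        (P : probability T R).

Definition filtration (G : R -> set (set T)) : Prop :=
  (forall t, 0 <= t -> sigma_algebra setT (G t) /\ G t `<=` measurable) /\
  (forall s t, 0 <= s -> s <= t -> G s `<=` G t).

Definition counting_path (N : R -> nat) : Prop :=
  [/\ N 0 = 0%N,
      (forall s t, 0 <= s -> s <= t -> (N s <= N t)%N) &
      (forall t, 0 <= t -> \forall s \near t^'+, N s = N t)].

(* A finite family of mutually independent Poisson processes relative to the
   filtration [G]: the vector of increments over ]s, t] is independent of [G s]
   and has independent Poisson coordinates. *)
Definition poisson_family (I : finType) (G : R -> set (set T)) (rate : I -> R)
    (N : I -> R -> T -> nat) : Prop :=
  [/\ (forall j t a, 0 <= t -> G t [set w | N j t w = a]),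
      {ae P, forall w, forall j, counting_path (fun t => N j t w)} &
      (forall s t, 0 <= s -> s < t ->
       forall B, G s B -> forall a : I -> nat,
         P (B `&` [set w | forall j, N j t w = (N j s w + a j)%N]) =
         (P B * (\prod_j poisson_pmf (rate j * (t - s)) (a j))%:E)%E)].

End driving_processes.

Definition jumps_at {R : realType} (N : R -> nat) (t : R) : Prop :=
  \forall s \near t^'-, (N s < N t)%N.

Section jsq.
Context {R : realType} (n b : nat).

Definition state : finType := {ffun 'I_n -> 'I_b.+1}.

Definition Qn (i : nat) (x : state) : nat := #|[pred k : 'I_n | (i <= x k)%N]|.

Definition Xn (i : nat) (x : state) : R :=
  (Num.sqrt n%:R)^-1 * ((Qn i x)%:R - (if i == 1%N then n%:R else 0)).

Definition shortest (x : state) (k : 'I_n) : Prop :=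
  forall j, (x k <= x j)%N.

(* When a shortest queue is full, all are, and the job is rejected. *)
Definition arrive (x : state) (k : 'I_n) : state :=
  if (x k < b)%N then [ffun j => if j == k then inord (x k).+1 else x j] else x.

Definition depart (x : state) (k : 'I_n) : state :=
  [ffun j => if j == k then inord (x k).-1 else x j].

(* A tie-breaking policy may use the service rates, the queue lengths, and any
   further information (history, clocks, external randomization), recorded as a
   point of an arbitrary measurable space. *)
Record policy := Policy {
  info_display : measure_display;
  info : measurableType info_display;
  route : ('I_n -> R) -> state -> info -> 'I_n;
  routeP : forall m x z, shortest x (route m x z) }.

(* [None] indexes the arrivals and [Some k] the service completions of
   server [k]; a completion epoch at an idle server has no effect, so that the
   service times at server [k] are i.i.d. exponential of rate [m k]. *)
Definition event_rate (lam : R) (m : 'I_n -> R) (j : option 'I_n) : R :=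
  if j is Some k then m k else n%:R * lam.

Definition after_event (pi : policy) (m : 'I_n -> R) (j : option 'I_n)
    (x : state) (z : info pi) : state :=
  if j is Some k then depart x k else arrive x (route m x z).

Definition jsq_path (pi : policy) (m : 'I_n -> R) (N : option 'I_n -> R -> nat)
    (z : R -> info pi) (q : R -> state) : Prop :=
  (forall t, 0 <= t -> \forall s \near t^'+, q s = q t) /\
  (forall t, 0 < t -> exists x : state,
    [/\ \forall s \near t^'-, q s = x,
        (forall j, jumps_at (N j) t -> q t = after_event m j x (z t)) &
        ((forall j, ~ jumps_at (N j) t) -> q t = x)]).

(* Shift-invariance of the finite-dimensional laws of (q, z). *)
Definition stationary_process (pi : policy) (d : measure_display)
    (T : measurableType d) (P : probability T R)
    (q : R -> T -> state) (z : R -> T -> info pi) : Prop :=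
  forall (h : R) (l : nat) (t : 'I_l -> R) (x : 'I_l -> state)
    (B : 'I_l -> set (info pi)),
    0 <= h -> (forall i, 0 <= t i) -> (forall i, measurable (B i)) ->
    P [set w | forall i, q (t i + h) w = x i /\ B i (z (t i + h) w)] =
    P [set w | forall i, q (t i) w = x i /\ B i (z (t i) w)].

(* The filtration makes the policy non-anticipating: arrivals and service
   completions after time t are independent of all that was used up to t. *)
Definition stationary_law (pi : policy) (lam : R) (m : 'I_n -> R)
    (p : state -> R) : Prop :=
  exists (d : measure_display) (T : measurableType d) (P : probability T R)
    (G : R -> set (set T)) (N : option 'I_n -> R -> T -> nat)
    (z : R -> T -> info pi) (q : R -> T -> state),
    filtration G /\
    poisson_family P G (event_rate lam m) N /\
    (forall t, 0 <= t -> forall x, G t [set w | q t w = x]) /\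
    (forall t, 0 <= t -> forall B, measurable B -> G t (z t @^-1` B)) /\
    {ae P, forall w, jsq_path m (fun j t => N j t w) (z^~ w) (q^~ w)} /\
    stationary_process P q z /\
    (forall x, P [set w | q 0 w = x] = (p x)%:E).

(* A stationary version of the system with random rate vector [mu] on the
   event [A]: a measurable choice, as a function of the rate vector, of a
   stationary law of the system with that rate vector. *)
Definition stationary_version (pi : policy) (lam : R) (d : measure_display)
    (T : measurableType d) (P : probability T R) (mu : T -> 'I_n -> R)
    (A : set T) (p : ('I_n -> R) -> state -> R) : Prop :=
  (forall x, measurable_fun A (fun w => p (mu w) x)) /\
  {ae P, forall w, A w -> stationary_law pi lam (mu w) (p (mu w))}.

Definition law_mean (p : state -> R) (g : state -> R) : R :=
  \sum_(x : state) p x * g x.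

Definition nu_n (m : 'I_n -> R) : R :=
  Num.sqrt n%:R * (n%:R^-1 * (\sum_(k < n) m k) - 1).

Definition varsigma_n (lam : R) : R := Num.sqrt n%:R * (1 - lam).

Definition slack_event (eps lam : R) (T : Type) (mu : T -> 'I_n -> R) : set T :=
  [set w | eps < varsigma_n lam + nu_n (mu w)].

(* E[|X_i(infinity)| | A]: the conditional law of the rate vector given A
   averages the stationary means. *)
Definition stationary_cond_mean (d : measure_display) (T : measurableType d)
    (P : probability T R) (mu : T -> 'I_n -> R) (A : set T)
    (p : ('I_n -> R) -> state -> R) (i : nat) : \bar R :=
  cond_expectation P A (fun w => law_mean (p (mu w)) (fun x => `|Xn i x|)).

End jsq.

(* Main.v *)
Require Import Defs.
From HB Require Import structures.
From mathcomp Require Import all_boot all_order all_algebra.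
From mathcomp Require Import all_classical all_reals all_analysis.
From mathcomp Require Import measurable_realfun ring lra.

Set Implicit Arguments.
Unset Strict Implicit.
Unset Printing Implicit Defensive.

Import Order.TTheory GRing.Theory Num.Theory.
Import numFieldNormedType.Exports.

Local Open Scope classical_set_scope.
Local Open Scope ring_scope.

(* Fix the rates and let delta be the total service rate minus the arrival rate, so
   that delta >= eps sqrt n on the slack event. Stationarity, tested over an interval
   of vanishing length, says that the generator of the queue-length process has mean
   zero on every function whose value after an arrival does not depend on how ties
   are broken. Write I for the number of idle servers, U for the number of jobs in
   excess of one per server, and Y for the rate of departures from servers with at
   least two jobs.
   - Testing on I^2 gives E[I] = O(delta + sqrt n) and bounds E[I Y].
   - Testing on (U - I)^2, the square of the total number of jobs centred at n, gives
     delta E[U] <= C (delta E[I] + n + E[I Y]), hence E[U] = O(delta + sqrt n).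
   - E[Q_3] is at most C n P(Q_2 = n). For V = U + bowl(I), with a bowl-shaped penalty
     of width of order n, the drift is at most - c sqrt n wherever V >= n / 4: an idle
     server makes U decrease at rate Y, and no idle server makes U - I decrease at
     rate delta. Testing on the squares of (V - n / 4)^+ and (V - n / 2)^+ gives
     P(Q_2 = n) = O(1 / n), uniformly in delta.
   Averaging over the rates only uses that E|nu^n| is bounded. *)

(** * A bowl-shaped penalty *)

Section positive_part.
Context {R : realType}.
Implicit Types y d v a K i : R.

Definition pos y : R := Num.max y 0.

Lemma pos_ge0 y : 0 <= pos y.
Proof. by rewrite le_max lexx orbT. Qed.

Lemma le_pos y : y <= pos y.
Proof. by rewrite le_max lexx. Qed.

Lemma pos_eq0 y : y <= 0 -> pos y = 0.
Proof. by move=> ?; apply/max_idPr. Qed.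

(** The square of the positive part has derivative [2 * pos y] and second derivative at most 2, so
    the second-order Taylor bound survives the kink at 0. *)
Lemma sqr_posD y d : pos (y + d) ^+ 2 <= pos y ^+ 2 + 2 * pos y * d + d ^+ 2.
Proof. by rewrite /pos; case: (leP (y + d) 0); case: (leP y 0); nra. Qed.

(** A step of size at most 1 can exceed [a] only when it starts at [a - 1] or above, so the
    second-order term is charged on that event alone. *)
Lemma sqr_pos_step v v' a : `|v' - v| <= 1 ->
  pos (v' - a) ^+ 2 - pos (v - a) ^+ 2 <=
  2 * pos (v - a) * (v' - v) + (a - 1 <= v)%R%:R.
Proof.
rewrite ler_norml => /andP[d1 d2].
have := sqr_posD (v - a) (v' - v); rewrite (_ : v - a + (v' - v) = v' - a); last by ring.
have [va|va] := leP (a - 1) v => /= h; first by nra.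
by rewrite !pos_eq0; lra.
Qed.

(* A convex penalty for idleness: slope [-1] at [0], slope [0] beyond [K], and
   curvature [1 / K]. *)
Definition bowl K i : R := pos (K - i) ^+ 2 / (2 * K).

Lemma pos_sub_le K i : 0 < K -> 0 <= i -> pos (K - i) <= K.
Proof. by move=> K0 i0; rewrite /pos; case: (leP (K - i) 0); lra. Qed.

Lemma bowl_bounds K i : 0 < K -> 0 <= i -> 0 <= bowl K i <= K / 2.
Proof.
move=> K0 i0; have p0 := pos_ge0 (K - i); have pK := pos_sub_le K0 i0.
rewrite /bowl; apply/andP; split; first by rewrite divr_ge0 ?sqr_ge0//; lra.
rewrite ler_pdivrMr; last by lra.
by rewrite expr2; nra.
Qed.

Lemma bowlD K i d : 0 < K ->
  bowl K (i + d) - bowl K i <= - (pos (K - i) / K) * d + d ^+ 2 / (2 * K).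
Proof.
move=> K0; have := sqr_posD (K - i) (- d).
rewrite (_ : K - i + - d = K - (i + d)); last by ring.
move=> h; have -> : - (pos (K - i) / K) * d + d ^+ 2 / (2 * K) =
    (d ^+ 2 - 2 * pos (K - i) * d) / (2 * K) by field; exact: lt0r_neq0.
rewrite /bowl -mulrBl ler_pM2r; last by rewrite invr_gt0; lra.
by move: h; rewrite sqrrN mulrN; lra.
Qed.

Lemma bowl_step K i : 0 < K -> 0 <= i -> - 1 <= bowl K (i + 1) - bowl K i <= 0.
Proof.
move=> K0 i0; have := pos_sub_le K0 i0.
have pp : pos (K - i) - 1 <= pos (K - (i + 1)) <= pos (K - i).
  by rewrite /pos; case: (leP (K - i) 0); case: (leP (K - (i + 1)) 0); lra.
have p0 := pos_ge0 (K - (i + 1)).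
move=> pK; rewrite /bowl -mulrBl; apply/andP; split.
  by rewrite ler_pdivlMr; [nra|lra].
by rewrite pmulr_lle0 ?invr_gt0; [nra|lra].
Qed.

End positive_part.

(** * Drift of the generator *)

Section generator.
Context {R : realType} {n b : nat}.
Implicit Types (x : state n b) (k : 'I_n) (f : state n b -> R).

Definition server_sum (g : nat -> R) x : R := \sum_(j < n) g (x j).

(** On such functions all policies share one generator, so an arbitrary selection [sq] of a shortest
    queue represents every policy. *)
Definition tie_blind f : Prop :=
  forall x k k', shortest x k -> shortest x k' -> f (arrive x k) = f (arrive x k').

Definition generator (lam : R) (m : 'I_n -> R) (sq : state n b -> 'I_n) f x : R :=
  n%:R * lam * (f (arrive x (sq x)) - f x) +
  \sum_(k < n) m k * (f (depart x k) - f x).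

Lemma server_sum_update (g : nat -> R) x (y : state n b) k :
  (forall j, j != k -> y j = x j) ->
  server_sum g y = server_sum g x + (g (y k) - g (x k)).
Proof.
move=> yx; rewrite /server_sum (bigD1 k)//= [in RHS](bigD1 k)//=.
rewrite (eq_bigr (fun j => g (x j))) => [|j jk]; last by rewrite yx.
by ring.
Qed.

Lemma server_sum_arrive (g : nat -> R) x k :
  server_sum g (arrive x k) =
  server_sum g x + (if (x k < b)%N then g (x k).+1 - g (x k) else 0).
Proof.
rewrite /arrive; case: ifPn => xb; last by rewrite addr0.
rewrite (@server_sum_update _ x _ k) ?ffunE ?eqxx ?inordK//.
by move=> j /negPf jk; rewrite ffunE jk.
Qed.

Lemma server_sum_depart (g : nat -> R) x k :
  server_sum g (depart x k) = server_sum g x + (g (x k).-1 - g (x k)).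
Proof.
rewrite (@server_sum_update _ x _ k) ?ffunE ?eqxx ?inordK//.
  by rewrite (leq_ltn_trans (leq_pred _)).
by move=> j /negPf jk; rewrite ffunE jk.
Qed.

Lemma shortest_eq x k k' : shortest x k -> shortest x k' -> x k = x k' :> nat.
Proof. by move=> sk sk'; apply/eqP; rewrite eqn_leq sk sk'. Qed.

Definition idle : state n b -> R := server_sum (fun i => (i == 0)%N%:R).
(** The truncated predecessor gives idle servers weight 0, so [excess x - idle x] is the total
    number of jobs minus [n]; [excess2] likewise ignores the first two jobs of each queue. *)
Definition excess : state n b -> R := server_sum (fun i => i.-1%:R).
Definition excess2 : state n b -> R := server_sum (fun i => (i - 2)%N%:R).
Definition count_ge (i : nat) : state n b -> R := server_sum (fun j => (i <= j)%N%:R).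

Lemma count_geE i x : count_ge i x = (Qn i x)%:R.
Proof.
rewrite /count_ge /server_sum /Qn -sum1_card natr_sum [RHS]big_mkcond/=.
by apply: eq_bigr => j _; rewrite inE; case: (_ <= _)%N.
Qed.

Lemma server_sum_ge0 (g : nat -> R) x : (forall i, 0 <= g i) -> 0 <= server_sum g x.
Proof. by move=> g0; apply: sumr_ge0. Qed.

Lemma le_server_sum (g g' : nat -> R) x : (forall j, g (x j) <= g' (x j)) ->
  server_sum g x <= server_sum g' x.
Proof. by move=> gg; apply: ler_sum. Qed.

Lemma idle_count_ge x : idle x = n%:R - count_ge 1 x.
Proof.
apply/eqP; rewrite eq_sym subr_eq -big_split/=.
rewrite (eq_bigr (fun=> 1)) ?sumr_const ?card_ord// => j _.
by case: (nat_of_ord (x j)) => [|i] /=; rewrite ?addr0 ?add0r.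
Qed.

Lemma tie_blind_server_sum (g : nat -> R) : tie_blind (server_sum g).
Proof.
by move=> x k k' sk sk'; rewrite !server_sum_arrive (shortest_eq sk sk').
Qed.

Lemma tie_blind2 (F : R -> R -> R) f g : tie_blind f -> tie_blind g ->
  tie_blind (fun x => F (f x) (g x)).
Proof. by move=> tf tg x k k' sk sk'; rewrite (tf _ k k')// (tg _ k k'). Qed.

Definition service_rate (m : 'I_n -> R) (a : pred nat) x : R :=
  \sum_(k < n) m k * (a (x k))%:R.

Section mean.
Variable p : state n b -> R.

Lemma law_mean_affine (a c c' : R) f g : \sum_x p x = 1 ->
  law_mean p (fun x => a * f x + c * g x + c') =
  a * law_mean p f + c * law_mean p g + c'.
Proof.
move=> p1; rewrite /law_mean !mulr_sumr -[c' in RHS]mulr1 -p1 mulr_sumr -!big_split/=.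
by apply: eq_bigr => x _; ring.
Qed.

Hypothesis p0 : forall x, 0 <= p x.

Lemma le_law_mean f g : (forall x, f x <= g x) -> law_mean p f <= law_mean p g.
Proof. by move=> fg; apply: ler_sum => x _; rewrite ler_wpM2l. Qed.

Lemma law_mean_ge0 f : (forall x, 0 <= f x) -> 0 <= law_mean p f.
Proof. by move=> f0; apply: sumr_ge0 => x _; rewrite mulr_ge0. Qed.

End mean.

(** * Drift inequalities for the test functions *)

Section rates.
Variables (lam mi M : R) (m : 'I_n -> R) (sq : state n b -> 'I_n).
Hypotheses (mi0 : 0 < mi) (mE : forall k, mi <= m k <= M).
Hypotheses (b0 : (0 < b)%N) (sqP : forall x, shortest x (sq x)).

(** [W] is the capacity wasted on idle servers; completions raise [idle] at rate [Z] and lower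
    [excess] at rate [Y]. *)
Local Notation W := (service_rate m (pred1 0%N)).
Local Notation Z := (service_rate m (pred1 1%N)).
Local Notation Y := (service_rate m (leq 2)).
Local Notation gen := (generator lam m sq).

Lemma m_ge0 k : 0 <= m k.
Proof. by have /andP[] := mE k => /(lt_le_trans mi0)/ltW. Qed.

Lemma service_rate_ge0 a x : 0 <= service_rate m a x.
Proof. by apply: sumr_ge0 => k _; rewrite mulr_ge0 ?m_ge0. Qed.

Lemma service_rate_bounds (a : pred nat) x :
  mi * server_sum (fun i => (a i)%:R) x <= service_rate m a x
    <= M * server_sum (fun i => (a i)%:R) x.
Proof.
rewrite /server_sum !mulr_sumr; apply/andP; split; apply: ler_sum => k _;
  by rewrite ler_wpM2r//; have /andP[] := mE k.
Qed.

Lemma service_rate_split x : W x + Z x + Y x = \sum_(k < n) m k.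
Proof.
rewrite -!big_split/=; apply: eq_bigr => k _; rewrite -!mulrDr.
by case: (nat_of_ord (x k)) => [|[|i]] /=; rewrite ?addr0 ?add0r mulr1.
Qed.

Lemma sum_m_le : \sum_(k < n) m k <= n%:R * M.
Proof.
rewrite mulr_natl -[X in _ *+ X](card_ord n) -sumr_const; apply: ler_sum => k _.
by have /andP[] := mE k.
Qed.

Lemma excess_bounds x : count_ge 2 x <= excess x <= b%:R * count_ge 2 x.
Proof.
rewrite /excess /count_ge; apply/andP; split.
  by apply: le_server_sum => j; rewrite ler_nat; case: (nat_of_ord (x j)) => [|[|]].
rewrite [leRHS]mulr_sumr; apply: ler_sum => j _; rewrite -natrM ler_nat.
case: (nat_of_ord (x j)) (leq_ord (x j)) => [|[|i]]//= ib.
by rewrite muln1 ltnW.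
Qed.

Lemma idle_ge1 x : x (sq x) = 0%N :> nat -> 1 <= idle x.
Proof.
move=> x0; rewrite /idle /server_sum (bigD1 (sq x))//= x0/= lerDl.
exact: sumr_ge0.
Qed.

Lemma idle_eq0 x : (0 < x (sq x))%N -> idle x = 0.
Proof.
move=> x0; apply: big1 => j _.
by have := leq_trans x0 (@sqP x j); case: (nat_of_ord (x j)).
Qed.

(** Each transition moves only one of the two coordinates: an arrival fills an idle server if there
    is one, and otherwise lengthens a queue unless all buffers are full. *)
Lemma generator_excess_idle (F : R -> R -> R) x :
  let u := excess x in let i := idle x in
  gen (fun x => F (excess x) (idle x)) x =
  n%:R * lam * (if (x (sq x) == 0 :> nat)%N then F u (i - 1) - F u i
                else if (x (sq x) < b)%N then F (u + 1) i - F u i else 0) +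
  Z x * (F u (i + 1) - F u i) + Y x * (F (u - 1) i - F u i).
Proof.
move=> u i; rewrite /generator -/u -/i -addrA; congr (_ * _ + _).
  rewrite /u /i /excess /idle !server_sum_arrive.
  case: (nat_of_ord (x (sq x))) => [|v]/=; first by rewrite b0 subrr sub0r addr0.
  case: ifP; last by rewrite !addr0 subrr.
  by rewrite subrr addr0 -(natr1 v) addrAC subrr add0r.
rewrite /service_rate !mulr_suml -big_split/=; apply: eq_bigr => k _.
rewrite /u /i /excess /idle !server_sum_depart.
case: (nat_of_ord (x k)) => [|[|v]]/=.
- by rewrite !subrr !addr0; ring.
- by rewrite subrr subr0 addr0; ring.
- have -> : (v%:R - v.+1%:R : R) = - 1 by rewrite -(natr1 v); ring.
  by rewrite subrr addr0; ring.
Qed.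

(** With an idle server present, [idle] has drift [Z x - n%:R * lam], rewritten by
    [service_rate_split]. With none, the factor [idle x] kills the first-order term. *)
Lemma generator_idle_sq x : 0 <= n%:R * lam <= \sum_(k < n) m k ->
  gen (fun x => idle x ^+ 2) x <=
  2 * idle x * (\sum_(k < n) m k - n%:R * lam - W x - Y x) + 2 * (n%:R * M).
Proof.
move=> /andP[L0 LT]; rewrite (generator_excess_idle (fun _ i => i ^+ 2)).
have := service_rate_split x; have := sum_m_le.
have := service_rate_ge0 (pred1 0%N) x; have := service_rate_ge0 (pred1 1%N) x.
have := service_rate_ge0 (leq 2) x.
set L := _ * lam in L0 LT *; set T := \sum_(k < n) _ in LT *.
set w := W x; set z := Z x; set y := Y x => y0 z0 w0 TM Tw.
have [x0|x0] := eqVneq (nat_of_ord (x (sq x))) 0%N.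
  have -> : z = T - w - y by lra.
  by lra.
rewrite (_ : (if _ then _ else 0) = 0); last by case: ifP; rewrite ?subrr.
by rewrite idle_eq0 ?lt0n//; lra.
Qed.

(** The total number of jobs rises at the arrival rate and falls at the total service rate minus
    [W x]. A rejected arrival is harmless: then [idle x] is 0 and the missing term is nonnegative,
    as [excess x] is. *)
Lemma generator_surplus_sq x : 0 <= n%:R * lam <= \sum_(k < n) m k ->
  gen (fun x => (excess x - idle x) ^+ 2) x <=
  - 2 * (excess x - idle x) * (\sum_(k < n) m k - n%:R * lam - W x)
  + 2 * (n%:R * M).
Proof.
move=> /andP[L0 LT]; rewrite (generator_excess_idle (fun u i => (u - i) ^+ 2)).
have := service_rate_split x; have := sum_m_le.
have := service_rate_ge0 (pred1 0%N) x; have := service_rate_ge0 (pred1 1%N) x.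
have := service_rate_ge0 (leq 2) x.
set L := _ * lam in L0 LT *; set T := \sum_(k < n) _ in LT *.
set w := W x; set z := Z x; set y := Y x => y0 z0 w0 TM Tw.
set u := excess x; set i := idle x.
have u0 : 0 <= u by exact: server_sum_ge0.
have zE : z = T - w - y by lra.
case: ifPn => [_|x0]; first by rewrite zE; lra.
case: ifPn => xb; first by rewrite zE; lra.
have -> : i = 0 by apply: idle_eq0; rewrite lt0n.
have : 0 <= u * L by rewrite mulr_ge0.
by rewrite zE; lra.
Qed.

(** An arrival creates a third job somewhere only if the shortest queue already has two jobs, that
    is, if all [n] servers do. *)
Lemma generator_excess2 x : 0 <= n%:R * lam <= \sum_(k < n) m k ->
  gen excess2 x <= n%:R * M * (Qn 2 x == n)%:R - mi * count_ge 3 x.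
Proof.
move=> /andP[L0 LT]; rewrite /generator; apply: lerD.
  rewrite /excess2 server_sum_arrive [X in _ * X]addrAC subrr add0r.
  have [x2|x2] := ltnP (x (sq x)) 2.
    rewrite (_ : (if _ then _ else _) = 0) ?mulr0.
      by rewrite mulr_ge0// mulr_ge0// (le_trans (m_ge0 (sq x)))//; case/andP: (mE (sq x)).
    by case: ifP => // _; case: (nat_of_ord (x (sq x))) x2 => [|[|]]//=; rewrite subrr.
  have -> : Qn 2 x == n.
    apply/eqP; rewrite /Qn -[RHS]card_ord; apply: eq_card => j.
    by rewrite !inE (leq_trans x2)// sqP.
  rewrite mulr1 (le_trans _ (le_trans LT sum_m_le))// -[leRHS]mulr1 ler_wpM2l//.
  case: ifP => // _; case: (nat_of_ord (x (sq x))) x2 => [|[|v]]//= _.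
  by rewrite !subSS !subn0 -(natr1 v); lra.
have -> : - (mi * count_ge 3 x) = \sum_(k < n) mi * - (3 <= x k)%N%:R.
  by rewrite -mulr_sumr sumrN mulrN.
apply: ler_sum => k _.
rewrite /excess2 server_sum_depart [X in _ * X]addrAC subrr add0r.
have /andP[mk _] := mE k.
case: (nat_of_ord (x k)) => [|[|[|v]]]/=; rewrite ?subrr ?mulr0 ?oppr0 ?mulr0//.
have -> : ((v.+2 - 2)%N%:R - (v.+3 - 2)%N%:R : R) = - 1.
  by rewrite !subSS !subn0 -(natr1 v); ring.
by rewrite !mulrN1 lerN2.
Qed.

Definition potential K x : R := excess x + bowl K (idle x).

Lemma idle_ge0 x : 0 <= idle x.
Proof. exact: server_sum_ge0. Qed.

(** Let [s] in [0, 1] be minus the slope of the bowl at [idle x]. If a server idles, the first-order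
    drift is at most a mixture, with weights [1 - s] and [s], of [- (Y x - M * K)] and minus the
    slack, both at most [- c]. If none idles then [s = 1] and the slack alone acts. The curvature
    costs [n%:R * M / K]. *)
Lemma generator_potential K c x : 0 < K -> 0 <= n%:R * lam <= \sum_(k < n) m k ->
  c <= Y x - M * K -> c <= \sum_(k < n) m k - n%:R * lam ->
  gen (potential K) x <= - c + n%:R * M / K.
Proof.
move=> K0 /andP[L0 LT] cY cd.
rewrite (generator_excess_idle (fun u i => u + bowl K i)).
have TM := sum_m_le; have Tw := service_rate_split x.
have w0 := service_rate_ge0 (pred1 0%N) x; have z0 := service_rate_ge0 (pred1 1%N) x.
have y0 := service_rate_ge0 (leq 2) x.
have /andP[_ wM] := service_rate_bounds (pred1 0%N) x.
have M0 : 0 <= M by rewrite (le_trans (m_ge0 (sq x)))//; case/andP: (mE (sq x)).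
have i0 := idle_ge0 x.
set L := _ * lam in L0 LT cd *; set T := \sum_(k < n) _ in LT cd TM Tw *.
set w := W x in Tw w0 wM *; set z := Z x in Tw z0 *; set y := Y x in Tw y0 cY *.
have := bowlD (idle x) 1 K0; have := bowlD (idle x) (- 1) K0.
have /andP[_ dn] := bowl_step K0 i0.
have := pos_sub_le K0 i0; have := pos_ge0 (K - idle x); have := le_pos (K - idle x).
change (server_sum _ _) with (idle x) in wM.
set i := idle x in i0 wM dn *; set u := excess x.
set s := pos (K - i) / K; set p := pos (K - i); set h := n%:R * M / K.
set B0 := bowl K i; set B1 := bowl K (i + 1) in dn *; set Bm := bowl K (i - 1).
rewrite sqrrN expr1n mulrN1 opprK mulr1 => pl p0 pK hm h1.
have pE : p = s * K by rewrite /p /s divfK// lt0r_neq0.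
have hE : (L + z) * (1 / (2 * K)) <= h.
  have -> : (L + z) * (1 / (2 * K)) = (L + z) / 2 / K by field; exact: lt0r_neq0.
  by rewrite /h ler_pM2r ?invr_gt0//; lra.
have s0 : 0 <= s by rewrite divr_ge0// ltW.
have s1 : s <= 1 by rewrite ler_pdivrMr// mul1r.
have g0 : 0 <= 1 / (2 * K) by rewrite divr_ge0//; lra.
set g := 1 / (2 * K) in hm h1 hE g0.
have Lg : 0 <= L * g by rewrite mulr_ge0.
have h0 : 0 <= h by rewrite divr_ge0 ?mulr_ge0// ltW.
have zB : z * (B1 - B0) <= z * (- s + g) by rewrite ler_wpM2l.
have zB0 : z * (B1 - B0) <= 0 by rewrite mulr_ge0_le0.
case: ifPn => [_|x0].
  have LB : L * (Bm - B0) <= L * (s + g) by rewrite ler_wpM2l.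
  (* Wasted capacity is at most [M * i]; for [i <= K] one has [i = K * (1 - s)], and beyond [K] the
     slope vanishes. *)
  have sw : s * w <= M * K * (1 - s).
    rewrite (@le_trans _ _ (s * (M * i)))// ?ler_wpM2l//.
    have [iK|iK] := leP i K; last first.
      rewrite {1}/s /p pos_eq0 ?mul0r ?mul0r; last by lra.
      by rewrite !mulr_ge0 ?subr_ge0// ltW.
    have pi : p = K - i by rewrite /p /pos max_l//; lra.
    have iE : i <= K * (1 - s) by lra.
    have : M * i <= M * K * (1 - s) by rewrite -mulrA ler_wpM2l.
    have : 0 <= M * i by rewrite mulr_ge0.
    by nra.
  have a1 : 0 <= (1 - s) * (y - M * K - c) by rewrite mulr_ge0; lra.
  have a2 : 0 <= s * (T - L - c) by rewrite mulr_ge0; lra.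
  have -> : L * (u + Bm - (u + B0)) + z * (u + B1 - (u + B0)) + y * (u - 1 + B0 - (u + B0))
      = L * (Bm - B0) + z * (B1 - B0) - y by ring.
  have zE : z = T - w - y by lra.
  have : s * z = s * (T - w - y) by rewrite zE.
  by lra.
have -> : y * (u - 1 + B0 - (u + B0)) = - y by ring.
rewrite (_ : u + B1 - (u + B0) = B1 - B0); last by ring.
case: ifPn => xb.
  have -> : u + 1 + B0 - (u + B0) = 1 by ring.
  have iE : i = 0 by apply: idle_eq0; rewrite lt0n.
  have sE : s = 1 by rewrite /s /p iE subr0 /pos max_l ?divff ?lt0r_neq0// ltW.
  move: zB hE; rewrite sE; move: wM; rewrite iE mulr0; lra.
have : 0 <= M * K by rewrite mulr_ge0// ltW.
by lra.
Qed.

(** By [bowl_step] every transition moves the potential by at most 1, so [sqr_pos_step] applies to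
    each; the total transition rate is at most [2 * (n%:R * M)]. *)
Lemma generator_sqr_pos_potential a K x : 0 < K ->
  0 <= n%:R * lam <= \sum_(k < n) m k ->
  gen (fun x => pos (potential K x - a) ^+ 2) x <=
  2 * pos (potential K x - a) * gen (potential K) x +
  2 * (n%:R * M) * (a - 1 <= potential K x)%R%:R.
Proof.
move=> K0 /andP[L0 LT].
rewrite (generator_excess_idle (fun u i => pos (u + bowl K i - a) ^+ 2)).
rewrite (generator_excess_idle (fun u i => u + bowl K i)) /potential.
have TM := sum_m_le; have Tw := service_rate_split x.
have w0 := service_rate_ge0 (pred1 0%N) x; have z0 := service_rate_ge0 (pred1 1%N) x.
have y0 := service_rate_ge0 (leq 2) x; have i0 := idle_ge0 x.
set L := _ * lam in L0 LT *; set T := \sum_(k < n) _ in LT TM Tw *.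
set w := W x in Tw w0 *; set z := Z x in Tw z0 *; set y := Y x in Tw y0 *.
set i := idle x in i0 *; set u := excess x.
have := @sqr_pos_step _ (u + bowl K i) (u + bowl K (i + 1)) a.
have := @sqr_pos_step _ (u + bowl K i) (u - 1 + bowl K i) a.
set v := u + bowl K i; set q := pos (v - a); set I := (_ <= _)%R%:R.
have I0 : 0 <= I by [].
move=> /(_ _)/wrap[|sy].
  by rewrite /v (_ : _ - _ = - 1) ?normrN1//; ring.
move=> /(_ _)/wrap[|sz].
  rewrite /v (_ : _ - _ = bowl K (i + 1) - bowl K i); last by ring.
  by have := bowl_step K0 i0; rewrite ler_norml; lra.
have zz := ler_wpM2l z0 sz; have yy := ler_wpM2l y0 sy.
have LI : (L + z + y) * I <= 2 * (n%:R * M) * I by rewrite ler_wpM2r//; lra.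
have sL v' : `|v' - v| <= 1 -> L * (pos (v' - a) ^+ 2 - q ^+ 2) <= 2 * q * (L * (v' - v)) + L * I.
  by move=> /(@sqr_pos_step _ _ _ a) /(ler_wpM2l L0); rewrite -/q; lra.
case: ifPn => [x0|_].
  have i1 : 0 <= i - 1 by rewrite subr_ge0 idle_ge1//; exact/eqP.
  have := sL (u + bowl K (i - 1)); move=> /(_ _)/wrap[|ss]; last by lra.
  rewrite /v (_ : _ - _ = - (bowl K (i - 1 + 1) - bowl K (i - 1))); last by rewrite subrK; ring.
  by have := bowl_step K0 i1; rewrite normrN ler_norml; lra.
case: ifPn => _.
  have := sL (u + 1 + bowl K i); move=> /(_ _)/wrap[|ss]; last by lra.
  by rewrite /v (_ : _ - _ = 1) ?normr1//; ring.
have : 0 <= L * I by rewrite mulr_ge0.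
by lra.
Qed.

(** * Moment and tail bounds for a law under which generators have mean zero *)

Section stationary.
Variable p : state n b -> R.
Hypotheses (p0 : forall x, 0 <= p x) (p1 : \sum_x p x = 1).
Hypothesis pgen : forall f, tie_blind f -> law_mean p (gen f) = 0.
Hypothesis L0T : 0 <= n%:R * lam <= \sum_(k < n) m k.
Hypothesis n0 : (0 < n)%N.

Local Notation T := (\sum_(k < n) m k).
Local Notation s := (Num.sqrt (n%:R : R)).

Let s_ge1 : 1 <= s.
Proof. by rewrite -[leLHS]sqrtr1 ler_wsqrtr// ler1n. Qed.

Let s_sq : s * s = n%:R.
Proof. by rewrite -expr2 sqr_sqrtr. Qed.

Let M_gt0 : 0 < M.
Proof.
have /andP[mk kM] := mE (Ordinal n0).
by rewrite (lt_le_trans mi0)// (le_trans mk).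
Qed.

Lemma mean_generator_ge0 a c c' f g h : tie_blind f ->
  (forall x, gen f x <= a * g x + c * h x + c') ->
  0 <= a * law_mean p g + c * law_mean p h + c'.
Proof.
by move=> tf fg; rewrite -law_mean_affine// -(pgen tf) le_law_mean.
Qed.

(** Since [W x >= mi * idle x], the drift of [idle x ^+ 2] contains a negative square. It is
    replaced by its tangent at [t], which avoids second moments; [t] is of order slack plus [s], so
    that division by [t] leaves the claimed order. *)
Lemma mean_idle_le : mi * law_mean p idle <= T - n%:R * lam + (mi + M) * s.
Proof.
set del := T - _; have /andP[L0 LT] := L0T; have s1 := s_ge1; have M0 := M_gt0.
have del0 : 0 <= del by rewrite subr_ge0.
set t := del / mi + s.
have t0 : s <= t by rewrite lerDr divr_ge0// ltW.
have mt : mi * t = del + mi * s by rewrite /t mulrDr mulrCA divff ?mulr1// lt0r_neq0.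
have t_gt0 : 0 < t by lra.
have := @mean_generator_ge0 (- 2 * mi * t) 0 (2 * mi * t ^+ 2 + 2 * (n%:R * M))
  (fun x => idle x ^+ 2) idle idle.
move=> /(_ _ _)/wrap[| x | ].
- by apply: (tie_blind2 (fun u _ => u ^+ 2)); exact: tie_blind_server_sum.
- apply: (le_trans (generator_idle_sq x L0T)).
  have i0 := idle_ge0 x; have y0 := service_rate_ge0 (leq 2) x.
  have /andP[w0 _] := service_rate_bounds (pred1 0%N) x.
  change (server_sum _ _) with (idle x) in w0.
  rewrite -/del; set i := idle x in i0 w0 *.
  have iy : 0 <= i * Y x by rewrite mulr_ge0.
  have iw : i * (mi * i) <= i * W x by rewrite ler_wpM2l.
  have it : 0 <= mi * (i - t) ^+ 2 by rewrite mulr_ge0 ?sqr_ge0// ltW.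
  have dt : i * del <= i * (mi * t).
    by rewrite ler_wpM2l// mt lerDl mulr_ge0 ?sqrtr_ge0// ltW.
  by lra.
- set e := law_mean p idle => h.
  have h2 : t * (mi * e) <= t * (mi * t + M * s).
    have : s * s * M <= t * s * M by rewrite !ler_wpM2r ?sqrtr_ge0// ltW.
    rewrite s_sq => h3.
    by lra.
  by move: h2; rewrite ler_pM2l// mt; lra.
Qed.

(** The two squares are tested together, with weight [k] on [idle x ^+ 2]. From
    [excess <= b * count_ge 2], [W <= M * idle] and [Y >= mi * count_ge 2], this [k] is what lets
    the term [- k * (i * Y x)] absorb the bad term [u * W x]. *)
Lemma mean_excess_le eps : 0 < eps -> eps * s <= T - n%:R * lam ->
  law_mean p excess <= (1 + b%:R * M / mi) * (law_mean p idle + M / eps * s).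
Proof.
move=> eps0; set del := T - _ => epsd; have s1 := s_ge1; have M0 := M_gt0.
have del0 : 0 < del by rewrite (lt_le_trans _ epsd)// mulr_gt0//; lra.
set k := b%:R * M / mi.
have k0 : 0 <= k by rewrite divr_ge0 ?mulr_ge0// ltW.
have := @mean_generator_ge0 (- 2 * del) (2 * del * (1 + k)) ((1 + k) * (2 * (n%:R * M)))
  (fun x => (fun u i => (u - i) ^+ 2 + k * i ^+ 2) (excess x) (idle x)) excess idle.
move=> /(_ _ _)/wrap[| x | ].
- by apply: (tie_blind2 (fun u i => (u - i) ^+ 2 + k * i ^+ 2));
    exact: tie_blind_server_sum.
- have -> : gen (fun x => (excess x - idle x) ^+ 2 + k * idle x ^+ 2) x =
    gen (fun x => (excess x - idle x) ^+ 2) x + k * gen (fun x => idle x ^+ 2) x.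
    rewrite /generator [k * (_ + _)]mulrDr mulr_sumr addrACA -big_split/=; congr (_ + _); first by ring.
    by apply: eq_bigr => j _; ring.
  have g1 := generator_surplus_sq x L0T; have g2 := ler_wpM2l k0 (generator_idle_sq x L0T).
  apply: (le_trans (lerD g1 g2)); rewrite -/del.
  have i0 := idle_ge0 x; have w0 := service_rate_ge0 (pred1 0%N) x.
  have /andP[_ wM] := service_rate_bounds (pred1 0%N) x.
  have /andP[ym _] := service_rate_bounds (leq 2) x.
  change (server_sum _ _) with (idle x) in wM.
  change (server_sum _ _) with (count_ge 2 x) in ym.
  have /andP[q2 ub] := excess_bounds x.
  have q0 : 0 <= count_ge 2 x by exact: server_sum_ge0.
  set i := idle x in i0 wM *; set u := excess x in q2 ub *.
  have uw : u * W x <= k * (i * Y x).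
    have bq0 : 0 <= b%:R * count_ge 2 x by rewrite mulr_ge0.
    apply: (@le_trans _ _ (b%:R * count_ge 2 x * (M * i))).
      by apply: ler_pM => //; exact: le_trans q2.
    have -> : b%:R * count_ge 2 x * (M * i) = k * (i * (mi * count_ge 2 x)).
      by rewrite /k; field; exact: lt0r_neq0.
    by rewrite !ler_wpM2l.
  have iw : 0 <= i * W x by rewrite mulr_ge0.
  have := mulr_ge0 k0 iw.
  by lra.
- set e := law_mean p idle; set e' := law_mean p excess => h.
  rewrite -(ler_pM2l del0).
  have : n%:R * M <= del * (M / eps * s).
    have -> : n%:R * M = s * s * M by rewrite s_sq.
    have -> : s * s * M = eps * s * (M / eps * s) by field; exact: lt0r_neq0.
    by rewrite ler_wpM2r// !mulr_ge0 ?invr_ge0 ?sqrtr_ge0// ltW.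
  have k1 : 0 <= 1 + k by lra.
  by move=> /(ler_wpM2l k1); lra.
Qed.

Lemma mean_count_ge3_le :
  mi * law_mean p (count_ge 3) <= n%:R * M * law_mean p (fun x => (Qn 2 x == n)%:R).
Proof.
have := @mean_generator_ge0 (n%:R * M) (- mi) 0 excess2 (fun x => (Qn 2 x == n)%:R)
  (count_ge 3).
move=> /(_ _ _)/wrap[|x|]; [exact: tie_blind_server_sum | | lra].
by rewrite addr0 mulNr generator_excess2.
Qed.

(** Testing on the square of the overshoot above [a] needs negative drift only above [a], since the
    first-order term vanishes below. *)
Lemma mean_pos_potential_le K a c : 0 < K -> 0 <= c ->
  (forall x, a <= potential K x -> gen (potential K) x <= - c) ->
  c * law_mean p (fun x => pos (potential K x - a)) <=
  n%:R * M * law_mean p (fun x => (a - 1 <= potential K x)%R%:R).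
Proof.
move=> K0 c0 Vc.
have := @mean_generator_ge0 (- 2 * c) (2 * (n%:R * M)) 0
  (fun x => (fun u i => pos (u + bowl K i - a) ^+ 2) (excess x) (idle x))
  (fun x => pos (potential K x - a)) (fun x => (a - 1 <= potential K x)%R%:R).
move=> /(_ _ _)/wrap[|x|]; last by lra.
  by apply: (tie_blind2 (fun u i => pos (u + bowl K i - a) ^+ 2));
    exact: tie_blind_server_sum.
apply: (le_trans (generator_sqr_pos_potential a x K0 L0T)).
rewrite addr0 lerD2r; have [aV|/ltW aV] := leP a (potential K x).
  by have := ler_wpM2l (pos_ge0 (potential K x - a)) (Vc x aV); lra.
by rewrite pos_eq0 ?subr_le0//; lra.
Qed.

(** The bowl is at most [K / 2 <= n / 32], so at this level [excess x >= n / 8] and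
    [Y x >= mi * n / (8 * b)]. The choice of [K] makes [M * K] half of that, [c] fits under both
    available drifts, and the largeness condition lets half of [c * s] absorb the curvature cost
    [n%:R * M / K], a constant. *)
Lemma potential_level eps (K := mi / (16 * b%:R * M) * n%:R)
    (c := Num.min eps (mi / (16 * b%:R)))
    (x : state n b) :
  0 < eps -> eps * s <= T - n%:R * lam ->
  2 * (16 * b%:R * M ^+ 2 / mi) <= c * s ->
  n%:R / 4 <= potential K x -> gen (potential K) x <= - (c / 2 * s).
Proof.
move=> eps0 epsd large nV.
have M0 := M_gt0; have s1 := s_ge1.
have b1 : (1 : R) <= b%:R by rewrite ler1n.
have n1 : (1 : R) <= n%:R by rewrite ler1n.
have bM : 0 < 16 * b%:R * M by rewrite !mulr_gt0//; lra.
have miM : mi <= M by have /andP[mk] := mE (Ordinal n0); exact: le_trans.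
have kap : mi / (16 * b%:R * M) <= 1 / 16.
  rewrite ler_pdivrMr// (_ : 1 / 16 * _ = b%:R * M); last by field.
  by rewrite (le_trans miM)// ler_peMl// ltW.
have K0 : 0 < K by rewrite mulr_gt0 ?divr_gt0//; lra.
have Kn : K <= n%:R / 16.
  by rewrite /K [leRHS](_ : _ = 1 / 16 * n%:R) ?ler_wpM2r//; field.
have /andP[_ Bl] := bowl_bounds K0 (idle_ge0 x).
have u8 : n%:R / 8 <= excess x by move: nV; rewrite /potential; lra.
have /andP[_ ub] := excess_bounds x.
have /andP[ym _] := service_rate_bounds (leq 2) x.
change (server_sum _ _) with (count_ge 2 x) in ym.
have bR0 : b%:R != 0 :> R by rewrite lt0r_neq0//; lra.
have Yn : mi / (8 * b%:R) * n%:R <= Y x.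
  apply: le_trans ym; rewrite -(ler_pM2l (_ : 0 < b%:R)); last by lra.
  rewrite (_ : b%:R * _ = mi * (n%:R / 8)); last by field.
  by rewrite [leRHS]mulrCA ler_wpM2l//; [exact: ltW | exact: le_trans ub].
have MK : M * K = mi / (16 * b%:R) * n%:R.
  by rewrite /K; field; rewrite bR0 lt0r_neq0.
have mb0 : 0 < mi / (16 * b%:R) by rewrite divr_gt0//; lra.
have /andP[c1 c2] : (c <= eps) && (c <= mi / (16 * b%:R)).
  by rewrite ge_min lexx ge_min lexx orbT.
have sn : s <= n%:R.
  have : s * 1 <= s * s by rewrite ler_wpM2l ?sqrtr_ge0.
  by rewrite s_sq mulr1.
have cY : c * s <= Y x - M * K.
  rewrite MK (@le_trans _ _ (mi / (16 * b%:R) * n%:R))//.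
    by apply: ler_pM => //; rewrite le_min !ltW.
  rewrite lerBrDr -mulrDl (_ : _ + _ = mi / (8 * b%:R))//.
  by field.
have cd : c * s <= T - n%:R * lam.
  by apply: le_trans epsd; rewrite ler_wpM2r//; lra.
apply: (le_trans (generator_potential K0 L0T cY cd)).
have -> : n%:R * M / K = 16 * b%:R * M ^+ 2 / mi.
  by rewrite /K; field; rewrite bR0 !lt0r_neq0//; lra.
by lra.
Qed.

(* The tail estimate is bootstrapped: the trivial bound [1] at level [n / 4] gives
   order [n ^ (-1/2)] at level [n / 2], which gives order [1 / n] at level [n]. *)
Lemma mean_Qn2_full_le eps (c := Num.min eps (mi / (16 * b%:R)))
    (A := 2 * (16 * b%:R * M ^+ 2 / mi)) :
  0 < eps -> eps * s <= T - n%:R * lam ->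
  n%:R * law_mean p (fun x => (Qn 2 x == n)%:R) <=
  8 + (A / c) ^+ 2 + 16 * (2 * M / c) ^+ 2.
Proof.
move=> eps0 epsd; have s1 := s_ge1; have M0 := M_gt0.
have b1 : (1 : R) <= b%:R by rewrite ler1n.
have n1 : (1 : R) <= n%:R by rewrite ler1n.
have mb0 : 0 < mi / (16 * b%:R) by rewrite divr_gt0//; lra.
have c0 : 0 < c by rewrite lt_min eps0.
have A0 : 0 <= A.
  by rewrite mulr_ge0// divr_ge0 ?(ltW mi0)// mulr_ge0 ?sqr_ge0// mulr_ge0.
pose D := 2 * M / c; rewrite -/D.
pose pr f := law_mean p f.
have pr_le1 (P : pred (state n b)) : pr (fun x => (P x)%:R) <= 1.
  rewrite -[leRHS]p1; apply: ler_sum => x _.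
  by rewrite ler_piMr//; case: (P x).
have pr_ge0 (P : pred (state n b)) : 0 <= pr (fun x => (P x)%:R).
  by apply: law_mean_ge0.
have AC0 := sqr_ge0 (A / c); have D0 := sqr_ge0 D.
have q1 := pr_le1 (fun x => Qn 2 x == n); have q0 := pr_ge0 (fun x => Qn 2 x == n).
rewrite -/(pr _); set q := pr _ in q0 q1 *.
(* The first two summands of the bound cover [n <= 8] and [c * s < A], where a probability at most 1
   suffices. *)
have [n8|n8] := leP (n%:R : R) 8; first by nra.
have [large|small] := leP A (c * s); last first.
  have sA : s <= A / c by rewrite ler_pdivlMr// mulrC ltW.
  have : s * s <= (A / c) ^+ 2 by rewrite expr2 ler_pM//; lra.
  by rewrite s_sq; nra.
pose K := mi / (16 * b%:R * M) * n%:R.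
have K0 : 0 < K by rewrite !mulr_gt0 ?invr_gt0 ?mulr_gt0//; lra.
have tail a : n%:R / 4 <= a ->
    pr (fun x => pos (potential K x - a)) <=
    D * s * pr (fun x => (a - 1 <= potential K x)%R%:R).
  move=> na; have cs0 : 0 < c / 2 * s by rewrite mulr_gt0//; lra.
  have := @mean_pos_potential_le K a (c / 2 * s) K0 (ltW cs0).
  move=> /(_ _)/wrap[x aV|].
    by apply: (potential_level eps0 epsd) => //; exact: le_trans aV.
  move=> h; rewrite -(ler_pM2l cs0); apply: (le_trans h).
  rewrite -/(pr _); set q' := pr _; clearbody q'.
  have -> : n%:R * M * q' = s * s * M * q' by rewrite s_sq.
  suff -> : c / 2 * s * (D * s * q') = s * s * M * q' by [].
  by rewrite /D; field; exact: lt0r_neq0.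
have markov a a' : a < a' ->
    (a' - a) * pr (fun x => (a' <= potential K x)%R%:R) <=
    pr (fun x => pos (potential K x - a)).
  move=> aa; rewrite /pr /law_mean mulr_sumr; apply: ler_sum => x _.
  rewrite mulrCA ler_wpM2l//; have [a'V|_] := leP a' (potential K x).
    by rewrite mulr1 (le_trans _ (le_pos _))// lerB.
  by rewrite mulr0 pos_ge0.
have Dp : 0 <= D by rewrite divr_ge0 ?mulr_ge0 ?(ltW c0) ?(ltW M0).
(* The level [n / 2 - 1] is the one that [tail] asks for at [n / 2]; its distance to [n / 4] is at
   least [n / 8] because [n > 8]. *)
have t1 : n%:R / 8 * pr (fun x => (n%:R / 2 - 1 <= potential K x)%R%:R) <= D * s.
  set q' := pr _; apply: (@le_trans _ _ ((n%:R / 2 - 1 - n%:R / 4) * q')).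
    by rewrite ler_wpM2r ?pr_ge0//; lra.
  have aa : n%:R / 4 < n%:R / 2 - 1 :> R by lra.
  apply: (le_trans (markov _ _ aa)); apply: (le_trans (tail _ (lexx _))).
  by apply: ler_piMr; [rewrite mulr_ge0 ?sqrtr_ge0 | exact: pr_le1].
have t2 : n%:R / 2 * pr (fun x => (n%:R <= potential K x)%R%:R) <=
    D * s * pr (fun x => (n%:R / 2 - 1 <= potential K x)%R%:R).
  set q' := pr _; apply: (@le_trans _ _ ((n%:R - n%:R / 2) * q')).
    by rewrite ler_wpM2r ?pr_ge0//; lra.
  have aa : n%:R / 2 < n%:R :> R by lra.
  by apply: (le_trans (markov _ _ aa)); apply: tail; lra.
have qV : q <= pr (fun x => (n%:R <= potential K x)%R%:R).
  apply: le_law_mean => // x; rewrite ler_nat; case: eqP => //= Qx.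
  suff -> : (n%:R <= potential K x) by [].
  have /andP[q2 _] := excess_bounds x; move: q2; rewrite count_geE Qx => q2.
  by have /andP[B0 _] := bowl_bounds K0 (idle_ge0 x); rewrite /potential; lra.
have t3 : s / 8 * pr (fun x => (n%:R / 2 - 1 <= potential K x)%R%:R) <= D.
  have s0 : 0 < s by lra.
  rewrite -(ler_pM2l s0); set q' := pr _ in t1 *.
  have -> : s * (s / 8 * q') = s * s / 8 * q' by field.
  by rewrite s_sq [leRHS]mulrC.
have := ler_wpM2l Dp t3; have n2 : (0 : R) <= n%:R / 2 by lra.
have := ler_wpM2l n2 qV.
by lra.
Qed.

End stationary.
End rates.
End generator.

(** * Sample paths *)

Section paths.
Context {R : realType}.

(** The indicator of [q t != q a] is continuous on the interval, so if it ended at 1 it would take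
    the value 1/2. *)
Lemma locally_constant_eq (S : eqType) (q : R -> S) (a c : R) : a <= c ->
  (forall t, a <= t < c -> \forall s \near t^'+, q s = q t) ->
  (forall t, a < t <= c -> \forall s \near t^'-, q s = q t) -> q c = q a.
Proof.
rewrite le_eqVlt => /predU1P[->//|ac] qr ql.
pose g (t : R) : R := if q t == q a then 0 else 1.
have gr t : a <= t < c -> g s @[s --> t^'+] --> g t.
  move=> /qr qt; apply: cvg_near_cst; apply: filterS qt => s qs.
  by rewrite /g qs.
have gl t : a < t <= c -> g s @[s --> t^'-] --> g t.
  move=> /ql qt; apply: cvg_near_cst; apply: filterS qt => s qs.
  by rewrite /g qs.
have gc : {within `[a, c], continuous g}.
  apply/continuous_within_itvP => //; split.
  - move=> t; rewrite in_itv/= => /andP[at_ tc].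
    by apply/left_right_continuousP; split; [apply: gl|apply: gr];
      rewrite ?at_ ?tc ?(ltW at_) ?(ltW tc).
  - by apply: gr; rewrite lexx.
  - by apply: gl; rewrite lexx ac.
apply/eqP; apply: contraT => qca.
have ga : g a = 0 by rewrite /g eqxx.
have gc1 : g c = 1 by rewrite /g (negPf qca).
have mid : Num.min (g a) (g c) <= 1 / 2 <= Num.max (g a) (g c).
  by rewrite ga gc1 (min_idPl ler01) (max_idPr ler01); lra.
have [t _] := IVT (ltW ac) gc mid.
by rewrite /g; case: ifP => _; lra.
Qed.

Lemma near_left_ex (t : R) (Q : set R) : (\forall s \near t^'-, Q s) -> exists s, Q s.
Proof. exact: (@filter_ex _ _ (at_left_proper_filter t)). Qed.

Lemma near_right_ex (t : R) (Q : set R) : (\forall s \near t^'+, Q s) -> exists s, Q s.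
Proof. exact: (@filter_ex _ _ (at_right_proper_filter t)). Qed.

Lemma counting_path_const_no_jump (N : R -> nat) (a c t : R) :
  counting_path N -> 0 <= a -> a < t <= c -> N a = N c -> ~ jumps_at N t.
Proof.
move=> [_ Nmono _] a0 /andP[at_ tc] Nac jt.
have jt' : \forall s \near t^'-, (N s < N t)%N /\ a < s.
  by apply: filterI; [exact: jt | exact: nbhs_left_gt].
have [s [st /ltW as_]] := near_left_ex jt'.
move: st; rewrite ltnNge => /negP; apply.
rewrite (leq_trans (Nmono t c _ tc))// ?(le_trans a0 (ltW at_))//.
by rewrite -Nac Nmono.
Qed.

(** The jump time is the supremum of the times with count 0; right-continuity excludes count 0
    there, and monotonicity bounds the count by [N h]. *)
Lemma counting_path_jump_time (N : R -> nat) (h : R) :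
  counting_path N -> 0 <= h -> N h = 1%N ->
  exists t, [/\ 0 < t <= h, N t = 1%N & forall s, 0 <= s < t -> N s = 0%N].
Proof.
move=> [N0 Nmono Nrc] h0 Nh.
pose E := [set s | 0 <= s <= h /\ N s = 0%N].
have E0 : E 0 by split; rewrite ?lexx.
have hE : has_sup E by split; [exists 0|exists h => s [/andP[_ ?] _]].
have t0 : 0 <= sup E by apply: ub_le_sup => //; exact: hE.2.
have th : sup E <= h by apply: ge_sup => [|s [/andP[_ ?] _]//]; exists 0.
have before s : 0 <= s < sup E -> N s = 0%N.
  move=> /andP[s0 st]; have e0 : 0 < sup E - s by rewrite subr_gt0.
  have [e [_ Ne]] := sup_adherent e0 hE.
  rewrite subKr => /ltW se; apply/eqP; rewrite -leqn0 -Ne; exact: Nmono.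
have Nt0 : N (sup E) <> 0%N.
  move=> Nt; have th' : sup E < h.
    by rewrite lt_neqAle th andbT; apply/eqP => tE; rewrite tE Nh in Nt.
  have [s [/= Ns [/= sh st]]] := near_right_ex
    (filterI (Nrc _ t0) (filterI (nbhs_right_lt th') (nbhs_right_gt (sup E)))).
  have : E s by split; [rewrite (le_trans t0 (ltW st)) ltW | rewrite Ns].
  by move=> /(ub_le_sup hE.2); rewrite leNgt st.
exists (sup E); split=> //.
  rewrite th andbT lt_neqAle t0 andbT; apply/eqP => tE.
  by apply: Nt0; rewrite -tE.
by apply/eqP; rewrite eqn_leq -{1}Nh Nmono//= lt0n; exact/eqP.
Qed.

Context (n b : nat) (pi : @policy R n b) (m : 'I_n -> R)
  (N : option 'I_n -> R -> nat) (z : R -> info pi) (q : R -> state n b).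
Hypotheses (qP : jsq_path m N z q) (NP : forall j, counting_path (N j)).

Lemma jsq_path_no_event (a c : R) : 0 <= a -> a <= c ->
  (forall j, N j a = N j c) -> q c = q a.
Proof.
move=> a0 ac Nac; apply: locally_constant_eq => // t /andP[at_ tc].
  by apply: qP.1; exact: le_trans at_.
have [x [qx _ qt]] := qP.2 t (le_lt_trans a0 at_).
rewrite qt// => j; apply: (counting_path_const_no_jump (NP j) a0 _ (Nac j)).
by rewrite at_.
Qed.

(** The path is constant before and after the only jump time [t], so [z t] is the one piece of
    routing information that matters. *)
Lemma jsq_path_one_event (h : R) j0 : 0 <= h ->
  (forall j, N j h = (j == j0)) -> exists t, q h = after_event m j0 (q 0) (z t).
Proof.
move=> h0 Nh; have Nh1 : N j0 h = 1%N by rewrite Nh eqxx.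
have [t [/andP[t0 th] Nt before]] := counting_path_jump_time (NP j0) h0 Nh1.
exists t; rewrite (@jsq_path_no_event t h) ?(ltW t0)//; last first.
  move=> j; have [->|jj] := eqVneq j j0; first by rewrite Nt Nh1.
  apply/eqP; rewrite eqn_leq; have [_ mono _] := NP j.
  by rewrite mono ?(ltW t0)//= Nh (negPf jj).
have [x [qx qj _]] := qP.2 t t0.
have jt : jumps_at (N j0) t.
  apply: filterS (filterI (nbhs_left_lt t) (nbhs_left_gt t0)) => s [/= st s0].
  by rewrite Nt before// st ltW.
rewrite (qj _ jt); congr after_event.
have [s [/= <- [/= st s0]]] := near_left_ex
  (filterI qx (filterI (nbhs_left_lt t) (nbhs_left_gt t0))).
apply: jsq_path_no_event; rewrite ?(ltW s0)// => j.
have [N0 mono _] := NP j; rewrite N0; have [->|jj] := eqVneq j j0.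
  by rewrite before// st ltW.
apply/esym/eqP; rewrite -leqn0 -(_ : N j h = 0%N) ?mono ?(ltW s0)//.
  by rewrite (le_trans (ltW st)).
by rewrite Nh (negPf jj).
Qed.

End paths.

(** * Stationarity and the generator *)

Lemma big_option (V : nmodType) (K : finType) (F : option K -> V) :
  \sum_e F e = F None + \sum_k F (Some k).
Proof.
rewrite (bigD1 None)//= (reindex_omap Some id) => [|[k|]]//.
by congr (_ + _); apply: eq_bigl => k; rewrite eqxx.
Qed.

Lemma sum_fine_measure (R : realType) (d : measure_display) (T : measurableType d)
    (P : probability T R) (K : finType) (A : K -> set T) (B : set T) :
  measurable B -> (forall k, measurable (A k)) -> trivIset setT A ->
  \sum_k fine (P (B `&` A k)) = fine (P (B `&` \bigcup_k A k)).
Proof.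
move=> mB mA tA; have mBA k : measurable (B `&` A k) by exact: measurableI.
have tBA : trivIset setT (fun k => B `&` A k) by exact: trivIset_setIl.
rewrite setI_bigcupr (measure_fin_bigcup _ finite_finset tBA)//.
rewrite sum_fine => [|k _]; last exact: fin_num_measure.
congr fine; apply/esym; apply: (fsbig_fwiden (index_enum K)).
- by move=> k _ /=; rewrite mem_index_enum.
- exact: index_enum_uniq.
- by move=> k [_ /(_ I)].
Qed.

Section balance.
Context (R : realType) (n b : nat) (pi : @policy R n b) (lam : R) (m : 'I_n -> R)
  (p : state n b -> R) (d : measure_display) (T : measurableType d)
  (P : probability T R) (G : R -> set (set T)) (N : option 'I_n -> R -> T -> nat)
  (z : R -> T -> info pi) (q : R -> T -> state n b).
Hypotheses (rate_gt0 : forall j, 0 < event_rate lam m j) (Gf : filtration G)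
  (NP : poisson_family P G (event_rate lam m) N)
  (qG : forall t, 0 <= t -> forall x, G t [set w | q t w = x])
  (qP : {ae P, forall w, jsq_path m (fun j t => N j t w) (z^~ w) (q^~ w)})
  (qst : stationary_process P q z)
  (q0 : forall x, P [set w | q 0 w = x] = (p x)%:E).

Let rate := event_rate lam m.
Let Lam := \sum_j rate j.

Let measurable_q t x : 0 <= t -> measurable [set w | q t w = x].
Proof. by move=> t0; have [_] := Gf.1 t t0; apply; exact: qG. Qed.

Let measurable_N j t a : 0 <= t -> measurable [set w | N j t w = a].
Proof. by move=> t0; have [_] := Gf.1 t t0; apply; have [+ _ _] := NP; apply. Qed.

Let bigcup_q t : \bigcup_x [set w | q t w = x] = setT.
Proof. by apply/seteqP; split=> // w _; exists (q t w). Qed.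

Let trivIset_q t : trivIset setT (fun x => [set w | q t w = x]).
Proof. by move=> x y _ _ [w [/= <- <-]]. Qed.

(** [None] stands for no event up to time [h], and [Some j] for exactly one, of type [j]. Counts are
    taken relative to time 0 because [N j 0 w = 0] holds only almost surely. *)
Let single_event (h : R) (e : option (option 'I_n)) : set T :=
  [set w | forall j, N j h w = (N j 0 w + (e == Some j))%N].

Let measurable_single_event h e : 0 <= h -> measurable (single_event h e).
Proof.
move=> h0; have -> : single_event h e = \bigcap_(j in setT) \bigcup_c
    ([set w | N j 0 w = c] `&` [set w | N j h w = (c + (e == Some j))%N]).
  apply/seteqP; split=> w /= ew j; first by move=> _; exists (N j 0 w); split=> //=; exact: ew.
  by have [c _ [/= <-]] := ew j I.
apply: fin_bigcap_measurable => // j _; apply: bigcupT_measurable => c.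
by apply: measurableI; exact: measurable_N.
Qed.

Let trivIset_single_event h : trivIset setT (single_event h).
Proof.
move=> e e' _ _ [w [ew ew']].
have ee j : (e == Some j) = (e' == Some j).
  have := ew' j; rewrite ew => /addnI; by do 2 case: (_ == _).
case: e ew ee => [j|] ew ee; first by apply/esym/eqP; rewrite -ee.
by case: e' ew' ee => // j _ /(_ j); rewrite eqxx.
Qed.

Let event_weight (h : R) (e : option (option 'I_n)) : R :=
  (if e is Some j then rate j * h else 1) * expR (- (Lam * h)).

Let prod_poisson_pmf h e : 0 < h ->
  \prod_j poisson_pmf (rate j * h) (e == Some j) = event_weight h e.
Proof.
move=> h0; rewrite /event_weight /Lam mulr_suml -sumrN expR_sum.
rewrite (eq_bigr (fun j => (if e == Some j then rate j * h else 1) *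
    expR (- (rate j * h)))); last first.
  move=> j _; rewrite /poisson_pmf mulr_gt0 ?rate_gt0//.
  by case: (e == _); rewrite ?expr1 ?expr0 ?factS fact0 divr1.
rewrite big_split/=; congr (_ * _); case: e => [j|]; last by rewrite big1.
rewrite (bigD1 j)//= eqxx big1 ?mulr1// => i ij.
by rewrite ifF//; apply/eqP => -[ji]; rewrite ji eqxx in ij.
Qed.

Let q_single_event h e x : 0 < h ->
  fine (P ([set w | q 0 w = x] `&` single_event h e)) = p x * event_weight h e.
Proof.
move=> h0; have [_ _ Pinc] := NP.
rewrite (Pinc 0 h (lexx 0) h0 _ (qG (lexx 0) x) (fun j => nat_of_bool (e == Some j))).
rewrite q0 -EFinM/= -prod_poisson_pmf//.
by under eq_bigr do rewrite subr0.
Qed.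

Let law_q h x : 0 <= h -> fine (P [set w | q h w = x]) = p x.
Proof.
move=> h0.
have := @qst h 1%N (fun=> 0) (fun=> x) (fun=> setT) h0 (fun=> lexx 0)
  (fun=> measurableT).
set A := [set _ | _]; set B := [set _ | _].
have -> : A = [set w | q h w = x].
  by apply/seteqP; split=> w; [move=> /(_ ord0)[]; rewrite add0r | split; rewrite ?add0r].
have -> : B = [set w | q 0 w = x] by apply/seteqP; split=> w; [move=> /(_ ord0)[] | split].
by move=> ->; rewrite q0.
Qed.

Lemma stationary_ge0 x : 0 <= p x.
Proof. by rewrite -lee_fin -q0 measure_ge0. Qed.

Lemma stationary_sum1 : \sum_x p x = 1.
Proof.
have := @sum_fine_measure _ _ _ P _ (fun x => [set w | q 0 w = x]) setT measurableT.
rewrite bigcup_q setIT probability_setT/= => <-; last exact: trivIset_q.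
  by apply: eq_bigr => x _; rewrite setTI q0.
by move=> x; exact: measurable_q.
Qed.

Variables (sq : state n b -> 'I_n) (f : state n b -> R).
Hypotheses (sqP : forall x, shortest x (sq x)) (fT : tie_blind f).

(** The arrival case uses [sq] instead of the policy's routing, which is legitimate for the
    tie-blind [f]. *)
Let target (e : option (option 'I_n)) x : R :=
  match e with
  | None => f x
  | Some None => f (arrive x (sq x))
  | Some (Some k) => f (depart x k)
  end.

Let joint h x y := fine (P ([set w | q 0 w = x] `&` [set w | q h w = y])).

Let joint_event h x y e := fine (P ([set w | q 0 w = x] `&`
  [set w | q h w = y] `&` single_event h e)).

(** Almost every path with the single event [e] ends where [f] takes the target value, so a state
    [y] with another value carries no mass. *)
Let joint_event_target h x y e : 0 < h ->
  joint_event h x y e * (f y - target e x) = 0.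
Proof.
move=> h0; have [->|fy] := eqVneq (f y) (target e x); first by rewrite subrr mulr0.
rewrite /joint_event; set S := (X in fine (P X)).
suff -> : P S = 0%E by rewrite mul0r.
have mS : measurable S.
  apply: measurableI; last by apply: measurable_single_event; exact: ltW.
  by apply: measurableI; apply: measurable_q => //; exact: ltW.
apply/(negligibleP _ mS); have [_ cN _] := NP.
apply: negligibleS (filterI qP cN) => w /= [[qx qy] ew] [qw cw].
have N0 j : N j 0 w = 0%N by have [] := cw j.
move/eqP: fy; apply; rewrite -qy -qx; case: e ew @S mS => [j0|] ew S mS /=.
  have Nh j : N j h w = (j == j0) by rewrite ew N0 add0n (inj_eq Some_inj) eq_sym.
  have [t ->] := jsq_path_one_event qw cw (ltW h0) Nh.
  by case: j0 {ew S mS Nh} => [k|]//=; apply: fT => //; exact: routeP.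
by rewrite (jsq_path_no_event qw cw (lexx 0) (ltW h0))// => j; rewrite ew addn0.
Qed.

Let sum_joint_r h x : 0 < h -> \sum_y joint h x y = p x.
Proof.
move=> h0; rewrite sum_fine_measure ?bigcup_q ?setIT ?q0//; try exact: measurable_q.
by move=> y; apply: measurable_q; exact: ltW.
Qed.

Let sum_joint_l h y : 0 < h -> \sum_x joint h x y = p y.
Proof.
move=> h0; rewrite -(@law_q h y (ltW h0)) -[in RHS](setIT [set w | _]) -(bigcup_q 0).
rewrite -sum_fine_measure//; last by move=> x; exact: measurable_q.
  by apply: eq_bigr => x _; rewrite /joint setIC.
by apply: measurable_q; exact: ltW.
Qed.

Let sum_joint_event h x e : 0 < h ->
  \sum_y joint_event h x y e = p x * event_weight h e.
Proof.
move=> h0; rewrite -q_single_event// -[in RHS](setIT (_ `&` _)) -(bigcup_q h).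
rewrite -sum_fine_measure//.
- by apply: eq_bigr => y _; rewrite /joint_event setIAC.
- by apply: measurableI; [exact: measurable_q | apply: measurable_single_event; exact: ltW].
- by move=> y; apply: measurable_q; exact: ltW.
Qed.

(** The mass of the paths with at least two events; its total is of order [h ^+ 2]. *)
Let rest h x y := joint h x y - \sum_e joint_event h x y e.

Let rest_ge0 h x y : 0 < h -> 0 <= rest h x y.
Proof.
move=> h0; have mB : measurable ([set w | q 0 w = x] `&` [set w | q h w = y]).
  by apply: measurableI; apply: measurable_q => //; exact: ltW.
have mE e : measurable (single_event h e) by apply: measurable_single_event; exact: ltW.
rewrite subr_ge0 sum_fine_measure// fine_le ?fin_num_measure//.
- by apply: measurableI => //; exact: fin_bigcup_measurable.
- by rewrite le_measure ?inE//; apply: measurableI => //; exact: fin_bigcup_measurable.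
Qed.

Let sum_event_weight h : \sum_e event_weight h e = (1 + Lam * h) * expR (- (Lam * h)).
Proof.
by rewrite -mulr_suml big_option -mulr_suml.
Qed.

Let sum_rest h : 0 < h ->
  \sum_x \sum_y rest h x y = 1 - (1 + Lam * h) * expR (- (Lam * h)).
Proof.
move=> h0; rewrite -sum_event_weight.
transitivity (\sum_x (p x - p x * \sum_e event_weight h e)); last first.
  by rewrite sumrB -mulr_suml stationary_sum1 mul1r.
apply: eq_bigr => x _; rewrite sumrB sum_joint_r// exchange_big/=.
by congr (_ - _); rewrite mulr_sumr; apply: eq_bigr => e _; rewrite sum_joint_event.
Qed.

Let mean_gen := law_mean p (generator lam m sq f).

(** Stationarity equates the means of [f] at times 0 and [h]. Splitting by the number of events,
    zero events contribute nothing and one event contributes the generator. *)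
Let balance h : 0 < h ->
  h * expR (- (Lam * h)) * mean_gen + \sum_x \sum_y rest h x y * (f y - f x) = 0.
Proof.
move=> h0; transitivity (\sum_x \sum_y joint h x y * (f y - f x)); last first.
  under eq_bigr do under eq_bigr do rewrite mulrBr.
  under eq_bigr do rewrite sumrB.
  rewrite sumrB exchange_big/=; apply/eqP; rewrite subr_eq0; apply/eqP.
  by apply: eq_bigr => x _; rewrite -!mulr_suml sum_joint_r ?sum_joint_l.
rewrite /mean_gen /law_mean mulr_sumr -big_split/=; apply: eq_bigr => x _.
transitivity (\sum_y (\sum_e joint_event h x y e * (f y - f x) + rest h x y * (f y - f x)));
  last by apply: eq_bigr => y _; rewrite -mulr_suml -mulrDl /rest addrCA subrr addr0.
rewrite big_split/=; congr (_ + _).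
transitivity (\sum_y \sum_e joint_event h x y e * (target e x - f x)); last first.
  apply: eq_bigr => y _; apply: eq_bigr => e _; apply/eqP.
  rewrite -subr_eq0 -mulrBr (_ : _ - _ = - (f y - target e x)); last by ring.
  by rewrite mulrN joint_event_target ?oppr0.
rewrite exchange_big/=; under eq_bigr do rewrite -mulr_suml sum_joint_event//.
rewrite big_option/= subrr mulr0 add0r big_option/=.
rewrite (_ : \sum_k _ = h * expR (- (Lam * h)) * p x *
    \sum_k m k * (f (depart x k) - f x)); last first.
  by rewrite mulr_sumr; apply: eq_bigr => k _; rewrite /event_weight /rate/=; ring.
by rewrite /generator /event_weight /rate/=; ring.
Qed.

(** In [balance] the generator term is linear in [h] and the remainder quadratic, so a nonzero mean
    fails for small [h]. *)
Lemma stationary_mean_generator : law_mean p (generator lam m sq f) = 0.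
Proof.
rewrite -/mean_gen; apply/eqP; apply: contraT; rewrite -normr_gt0.
set D := `|mean_gen| => D0.
pose B := \sum_x \sum_y `|f y - f x|.
have B0 : 0 <= B by apply: sumr_ge0 => x _; apply: sumr_ge0.
have fB x y : `|f y - f x| <= B.
  rewrite /B (bigD1 x)//= (bigD1 y)//= -addrA lerDl addr_ge0 ?sumr_ge0// => i _.
  exact: sumr_ge0.
have Lam0 : 0 <= Lam by apply: sumr_ge0 => j _; exact: ltW.
(* Chosen so that [h = D / den] gives both [Lam * h <= 1 / 4] and [B * Lam ^+ 2 * h <= D / 4],
   against a lower bound [D / 2]. *)
pose den := 4 * (B * Lam ^+ 2 + Lam * D + 1).
have LD0 : 0 <= Lam * D by rewrite mulr_ge0// ltW.
have BL0 : 0 <= B * Lam ^+ 2 by rewrite mulr_ge0// sqr_ge0.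
have den0 : 0 < den by rewrite /den; lra.
pose h := D / den; have h0 : 0 < h by rewrite divr_gt0.
have hden : h * den = D by rewrite /h divfK// lt0r_neq0.
have u0 : 0 <= Lam * h by rewrite mulr_ge0// ltW.
have u4 : Lam * h <= 1 / 4.
  by rewrite /h mulrA ler_pdivrMr// /den; lra.
have E1 : 1 - Lam * h <= expR (- (Lam * h)) by exact: expR_ge1Dx.
set E := expR _ in E1.
have bound : h * E * D <= B * (1 - (1 + Lam * h) * E).
  rewrite -sum_rest//; have /eqP := balance h0.
  rewrite addr_eq0 => /eqP bal.
  have -> : h * E * D = `|h * E * mean_gen|.
    by rewrite normrM gtr0_norm// mulr_gt0 ?expR_gt0.
  rewrite bal normrN mulr_sumr (le_trans (ler_norm_sum _ _ _))//; apply: ler_sum => x _.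
  rewrite mulr_sumr (le_trans (ler_norm_sum _ _ _))//; apply: ler_sum => y _.
  by rewrite normrM ger0_norm ?rest_ge0// mulrC ler_wpM2r ?rest_ge0.
have E2 : 1 - (1 + Lam * h) * E <= (Lam * h) ^+ 2 by nra.
have bound2 := le_trans bound (ler_wpM2l B0 E2).
have : h * (E * D) <= h * (B * Lam ^+ 2 * h).
  by move: bound2; rewrite exprMn; lra.
rewrite ler_pM2l// => bound3.
have E3 : D / 2 <= E * D by rewrite mulrC ler_wpM2r// ?(ltW D0)//; lra.
have : B * Lam ^+ 2 * h <= D / 4.
  by rewrite -hden /den; nra.
by lra.
Qed.

End balance.

(** * Averaging over the service rates *)

Section stationary_bounds.
Context (R : realType) (n b : nat) (pi : @policy R n b) (lam : R) (m : 'I_n -> R)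
  (p : state n b -> R) (mi M eps : R).
Hypotheses (n0 : (0 < n)%N) (b0 : (0 < b)%N) (lam0 : 0 < lam) (mi0 : 0 < mi)
  (eps0 : 0 < eps) (mE : forall k, mi <= m k <= M)
  (slack : eps < varsigma_n n lam + nu_n m) (plaw : stationary_law pi lam m p).

Local Notation s := (Num.sqrt (n%:R : R)).

Let sq (x : state n b) : 'I_n := [arg min_(k < Ordinal n0) (x k : nat)].

Let sqP x : shortest x (sq x).
Proof. by rewrite /sq; case: arg_minnP => //= k _ kP j; exact: kP. Qed.

Let p_gen : [/\ forall x, 0 <= p x, \sum_x p x = 1 &
  forall f, tie_blind f -> law_mean p (generator lam m sq f) = 0].
Proof.
have [d [T [P [G [N [z [q [Gf [NP [qG [_ [qP [qst q0]]]]]]]]]]]]] := plaw.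
have rate0 j : 0 < event_rate lam m j.
  case: j => [k|] /=; last by rewrite mulr_gt0// ltr0n.
  by have /andP[+ _] := mE k; exact: lt_le_trans.
split; first exact: stationary_ge0 q0.
  exact: stationary_sum1 Gf qG q0.
by move=> f fT; exact: (stationary_mean_generator rate0 Gf NP qG qP qst q0 sqP fT).
Qed.

Let s_gt0 : 0 < s.
Proof. by rewrite sqrtr_gt0 ltr0n. Qed.

(** Turns the slack event into the gap between total service and arrival rates. *)
Let slackE : s * (varsigma_n n lam + nu_n m) = \sum_(k < n) m k - n%:R * lam.
Proof.
have nn : n%:R != 0 :> R by rewrite pnatr_eq0 -lt0n.
have ss : s * s = n%:R by rewrite -expr2 sqr_sqrtr.
rewrite /varsigma_n /nu_n; set T := \sum_(k < n) _.
have -> : s * (s * (1 - lam) + s * (n%:R^-1 * T - 1)) = s * s * (n%:R^-1 * T - lam).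
  by ring.
by rewrite ss mulrBr mulVKf.
Qed.

Let slack_le : eps * s <= \sum_(k < n) m k - n%:R * lam.
Proof. by rewrite -slackE mulrC ler_wpM2l// ?sqrtr_ge0// ltW. Qed.

Let L0T : 0 <= n%:R * lam <= \sum_(k < n) m k.
Proof.
rewrite mulr_ge0 ?(ltW lam0)//= -subr_ge0 (le_trans _ slack_le)//.
by rewrite mulr_ge0 ?sqrtr_ge0// ltW.
Qed.

Let law_mean_scale (g g' : state n b -> R) : (forall x, g x = s^-1 * g' x) ->
  law_mean p g = s^-1 * law_mean p g'.
Proof.
by move=> gg; rewrite /law_mean mulr_sumr; apply: eq_bigr => x _; rewrite gg mulrCA.
Qed.

Lemma mean_Xn_ge0 i : 0 <= law_mean p (fun x => `|Xn i x| : R).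
Proof. by have [p0 _ _] := p_gen; exact: law_mean_ge0. Qed.

Let mean_X1E : law_mean p (fun x => `|Xn 1 x|) = s^-1 * law_mean p idle.
Proof.
apply: law_mean_scale => x; rewrite /Xn eqxx normrM ger0_norm ?invr_ge0 ?sqrtr_ge0//.
by rewrite -count_geE -normrN opprB -idle_count_ge ger0_norm// idle_ge0.
Qed.

Let mean_XiE i : (1 < i)%N ->
  law_mean p (fun x => `|Xn i x|) = s^-1 * law_mean p (count_ge i).
Proof.
move=> i1; apply: law_mean_scale => x.
rewrite /Xn gtn_eqF// subr0 normrM ger0_norm ?invr_ge0 ?sqrtr_ge0//.
by rewrite -count_geE ger0_norm//; exact: server_sum_ge0.
Qed.

Lemma mean_X1_le : law_mean p (fun x => `|Xn 1 x|) <=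
  (varsigma_n n lam + nu_n m + mi + M) / mi.
Proof.
have [p0 p1 pg] := p_gen.
have := mean_idle_le mi0 mE b0 sqP p0 p1 pg L0T n0.
rewrite -slackE mean_X1E ler_pdivlMr// => h.
rewrite -(ler_pM2l s_gt0) -mulrA mulVKf ?lt0r_neq0// mulrC (le_trans h)//.
by rewrite le_eqVlt; apply/orP; left; apply/eqP; ring.
Qed.

Lemma mean_X2_le : law_mean p (fun x => `|Xn 2 x|) <=
  (1 + b%:R * M / mi) * ((varsigma_n n lam + nu_n m + mi + M) / mi + M / eps).
Proof.
have [p0 p1 pg] := p_gen.
have := mean_excess_le mi0 mE b0 sqP p0 p1 pg L0T n0 eps0 slack_le.
have M0 : 0 <= M.
  by have /andP[] := mE (Ordinal n0) => /(le_trans (ltW mi0)); exact: le_trans.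
have h1 := mean_X1_le; rewrite mean_X1E in h1.
rewrite mean_XiE// => h; rewrite -(ler_pM2l s_gt0) mulVKf ?lt0r_neq0//.
apply: (le_trans _ (le_trans h _)).
  by apply: le_law_mean => // x; have /andP[] := @excess_bounds R _ _ x.
rewrite mulrCA ler_wpM2l ?addr_ge0 ?divr_ge0 ?mulr_ge0 ?(ltW mi0)//.
rewrite mulrDr [s * (M / eps)]mulrC lerD2r.
by rewrite -[leLHS](mulVKf (lt0r_neq0 s_gt0)) ler_wpM2l ?sqrtr_ge0.
Qed.

Definition full_const : R :=
  let c := Num.min eps (mi / (16 * b%:R)) in
  8 + (2 * (16 * b%:R * M ^+ 2 / mi) / c) ^+ 2 + 16 * (2 * M / c) ^+ 2.

Lemma mean_X3_le : law_mean p (fun x => `|Xn 3 x|) <= M / mi * full_const * s^-1.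
Proof.
have [p0 p1 pg] := p_gen.
have h3 := mean_count_ge3_le mi0 mE sqP p0 p1 pg L0T.
have hf := mean_Qn2_full_le mi0 mE b0 sqP p0 p1 pg L0T n0 eps0 slack_le.
have M0 : 0 <= M.
  by have /andP[] := mE (Ordinal n0) => /(le_trans (ltW mi0)); exact: le_trans.
rewrite mean_XiE// mulrC ler_wpM2r ?invr_ge0 ?sqrtr_ge0//.
rewrite -(ler_pM2l mi0) (le_trans h3)//.
have -> : mi * (M / mi * full_const) = M * full_const by field; exact: lt0r_neq0.
by rewrite mulrAC mulrC ler_wpM2l.
Qed.

End stationary_bounds.

(** * Passing to the conditional expectation *)

Lemma integral_probability_cst (R : realType) (d : measure_display)
    (T : measurableType d) (P : probability T R) (a : R) : (\int[P]_w a%:E = a%:E)%E.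
Proof.
rewrite -[RHS]mule1 -(@probability_setT _ _ _ P).
exact: (integral_cst P measurableT).
Qed.

(** The nonnegative majorant is integrated over the whole space instead of [A], and the
    normalization costs at most [rho^-1]. *)
Lemma cond_expectation_le (R : realType) (d : measure_display) (T : measurableType d)
    (P : probability T R) (A : set T) (f g : T -> R) (rho a c e : R) :
  0 < rho -> (rho%:E < P A)%E -> 0 <= a -> 0 <= c -> measurable A ->
  measurable_fun A f -> measurable_fun setT g ->
  {ae P, forall w, A w -> `|f w| <= a + c * `|g w|} ->
  ('E_P[fun w => `|g w|%R] <= e%:E)%E ->
  (cond_expectation P A f <= (rho^-1 * (a + c * e))%:E)%E.
Proof.
move=> rho0 rhoA a0 c0 mA mf mg fg; rewrite unlock => ge.
have mng : measurable_fun setT (fun w => `|g w|) by exact: measurableT_comp.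
have mcg : measurable_fun setT (fun w => (c * `|g w|)%:E).
  by apply/measurable_EFinP; apply: measurable_funM => //; exact: measurable_cst.
have If : (\int[P]_(w in A) (f w)%:E <= (a + c * e)%:E)%E.
  apply: (le_trans (lee_abs _)); apply: (le_trans (le_abse_integral _ mA _)).
    exact/measurable_EFinP.
  apply: (@le_trans _ _ (\int[P]_(w in A) (a%:E + (c * `|g w|)%:E))%E).
    apply: ae_ge0_le_integral => //.
    - by apply/measurable_EFinP; exact: measurableT_comp.
    - by move=> w _; rewrite -EFinD lee_fin addr_ge0 ?mulr_ge0.
    - apply: measurable_funTS; apply: emeasurable_funD => //; exact: measurable_cst.
  apply: (@le_trans _ _ (\int[P]_w (a%:E + (c * `|g w|)%:E))%E).
    apply: ge0_subset_integral => //.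
      by apply: emeasurable_funD => //; exact: measurable_cst.
    by move=> w _; rewrite -EFinD lee_fin addr_ge0 ?mulr_ge0.
  rewrite ge0_integralD//; last by move=> w _; rewrite lee_fin mulr_ge0.
  rewrite integral_probability_cst EFinD leeD2l//.
  under eq_integral do rewrite EFinM.
  rewrite ge0_integralZl_EFin//; last exact/measurable_EFinP.
  by rewrite EFinM lee_wpmul2l.
have PA : P A \is a fin_num by exact: fin_num_measure.
have rhoP : rho < fine (P A) by rewrite -lte_fin fineK.
have PA0 : 0 < fine (P A) by exact: lt_trans rhoP.
have e0 : 0 <= e.
  by rewrite -lee_fin (le_trans _ ge)// integral_ge0.
rewrite /cond_expectation (@le_trans _ _ ((fine (P A))^-1%:E * (a + c * e)%:E)%E)//.
  by rewrite lee_wpmul2l// lee_fin invr_ge0 ltW.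
rewrite -EFinM lee_fin ler_wpM2r ?addr_ge0 ?mulr_ge0//.
by rewrite lef_pV2 ?posrE// ltW.
Qed.

Lemma measurable_nu_n (R : realType) (d : measure_display) (T : measurableType d)
    (P : probability T R) (n : nat) (mu : 'I_n -> {RV P >-> R}) :
  measurable_fun setT (fun w => nu_n (fun k => mu k w)).
Proof.
rewrite /nu_n; apply: measurable_funM; first exact: measurable_cst.
apply: measurable_funB; last exact: measurable_cst.
apply: measurable_funM; first exact: measurable_cst.
by apply: measurable_sum => k; exact: measurable_funPT.
Qed.

(** A crude bound, growing with [n], that makes the mean of [nu_n] in absolute value finite for each
    fixed [n]. *)
Lemma abs_nu_n_le (R : realType) (n : nat) (m : 'I_n -> R) (M : R) :
  (forall k, 0 <= m k <= M) ->
  `|nu_n m| <= Num.sqrt n%:R * (n%:R^-1 * (n%:R * M) + 1).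
Proof.
move=> mE; rewrite normrM ger0_norm ?sqrtr_ge0// ler_wpM2l ?sqrtr_ge0//.
rewrite (le_trans (ler_normB _ _))// normr1 lerD2r normrM ger0_norm ?invr_ge0//.
rewrite ler_wpM2l ?invr_ge0// ger0_norm; last first.
  by apply: sumr_ge0 => k _; have /andP[] := mE k.
rewrite mulr_natl -[X in _ *+ X](card_ord n) -sumr_const.
by apply: ler_sum => k _; have /andP[] := mE k.
Qed.

Theorem theorem4p8 (R : realType) (mu_min mu_max : R)
    (hmin : 0 < mu_min) (hmin1 : mu_min <= 1) (hmax1 : 1 <= mu_max)
    (hminmax : mu_min < mu_max)
    (b : nat) (hb : (0 < b)%N)
    (lam : nat -> R) (hlam : forall n, (0 < n)%N -> 0 < lam n)
    (d : nat -> measure_display) (Om : forall n, measurableType (d n))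
    (P : forall n, probability (Om n) R)
    (mu : forall n, 'I_n -> {RV (P n) >-> R})
    (hmu : forall n (k : 'I_n) (w : Om n), mu_min <= mu n k w <= mu_max)
    (F : probability (measurableTypeR R) R) (sigma2F : R)
    (hFsupp : smallest_closed_interval (law_support F) mu_min mu_max)
    (hFmean : ('E_F[id] = 1)%E) (hFvar : ('V_F[id] = sigma2F%:E)%E)
    (d' : measure_display) (Om' : measurableType d') (P' : probability Om' R)
    (nu : {RV P' >-> R})
    (hnumean : P'.-integrable setT (EFin \o nu))
    (hnuvar : ('V_P'[nu] < +oo)%E)
    (hF : empirical_weak_cvg P (fun n w k => mu n k w) F)
    (hnu : cvg_in_distribution P (fun n w => nu_n (fun k => mu n k w)) P' nu)
    (hnuabs : 'E_(P n)[fun w => `|nu_n (fun k => mu n k w)|%R]%E @[n --> \oo]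
                --> 'E_P'[fun w => `|nu w|%R]%E)
    (varsigma : R) (hvarsigma : 0 < varsigma)
    (hvarsigma_n : varsigma_n n (lam n) @[n --> \oo] --> varsigma)
    (eps : R) (heps : 0 < eps)
    (hpos : exists2 rho : R, 0 < rho & forall n, (0 < n)%N ->
       (rho%:E < P n (slack_event eps (lam n) (fun w k => mu n k w)))%E) :
  exists C1 C2 C3 : R, forall n, (0 < n)%N ->
    forall (pi : @policy R n b) (p : ('I_n -> R) -> state n b -> R),
    let rates := fun (w : Om n) k => mu n k w in
    let A := slack_event eps (lam n) rates in
    stationary_version pi (lam n) (P n) rates A p ->
    [/\ (stationary_cond_mean (P n) rates A p 1 < C1%:E)%E,
        (stationary_cond_mean (P n) rates A p 2 < C2%:E)%E &
        (stationary_cond_mean (P n) rates A p 3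
           < (C3 * (Num.sqrt n%:R)^-1)%:E)%E].
Proof.
have [rho rho0 rhoA] := hpos.
have mu_bounds n w k : mu_min <= mu n k w <= mu_max by exact: hmu.
have [S S_ge] : exists S, forall n, `|varsigma_n n (lam n)| <= S.
  have : bounded_fun (fun n => varsigma_n n (lam n)).
    by apply: cvg_seq_bounded; apply/cvg_ex; exists varsigma.
  by move=> /(@filter_ex _ _ (@proper_pinfty_nbhs R))[S SP]; exists S => n; exact: SP.
pose Enu n := ('E_(P n)[fun w => `|nu_n (fun k => mu n k w)|%R])%E.
have Enu_fin n : Enu n \is a fin_num.
  rewrite /Enu unlock ge0_fin_numE; last by rewrite integral_ge0.
  set K := Num.sqrt n%:R * (n%:R^-1 * (n%:R * mu_max) + 1).
  apply: (@le_lt_trans _ _ (\int[P n]_w K%:E)%E); last first.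
    by rewrite integral_probability_cst ltry.
  apply: ge0_le_integral => //.
  - by apply/measurable_EFinP; apply: measurableT_comp => //; exact: measurable_nu_n.
  - move=> w _; rewrite lee_fin abs_nu_n_le// => k.
    by have /andP[h ->] := mu_bounds n w k; rewrite andbT (le_trans (ltW hmin)).
have [e e_ge] : exists e : R, forall n, (Enu n <= e%:E)%E.
  have nufin : ('E_P'[fun w => `|nu w|%R])%E \is a fin_num.
    rewrite unlock; have /integrableP[_ h] := hnumean.
    by rewrite ge0_fin_numE; [exact: h | rewrite integral_ge0].
  move: hnuabs; rewrite -(fineK nufin) => /fine_cvgP[_ cv].
  have : bounded_fun (fine \o Enu).
    by apply: cvg_seq_bounded; apply/cvg_ex; eexists; exact: cv.
  move=> /(@filter_ex _ _ (@proper_pinfty_nbhs R))[e eP]; exists e => n.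
  by rewrite -(fineK (Enu_fin n)) lee_fin (le_trans (ler_norm _))//; exact: eP.
have S0 : 0 <= S by exact: le_trans (S_ge 0%N).
have M0 : 0 < mu_max by exact: lt_trans hminmax.
pose k := 1 + b%:R * mu_max / mu_min.
have k0 : 0 <= k by rewrite addr_ge0// divr_ge0 ?mulr_ge0// ltW.
pose a1 := (S + mu_min + mu_max) / mu_min.
have a10 : 0 <= a1 by rewrite divr_ge0 ?addr_ge0// ltW.
pose a2 := k * (a1 + mu_max / eps).
have a20 : 0 <= a2 by rewrite mulr_ge0// addr_ge0// divr_ge0// ltW.
pose a3 := mu_max / mu_min * full_const b mu_min mu_max eps.
have a30 : 0 <= a3.
  apply: mulr_ge0; first by rewrite divr_ge0// ltW.
  apply: addr_ge0; last by apply: mulr_ge0 => //; exact: sqr_ge0.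
  by apply: addr_ge0 => //; exact: sqr_ge0.
(* The added 1 makes the inequalities strict. *)
have lt_add1 (y : R) (u : \bar R) : (u <= y%:E -> u < (y + 1)%:E)%E.
  by move=> uy; rewrite (le_lt_trans uy)// lte_fin ltrDl.
exists (rho^-1 * (a1 + mu_min^-1 * e) + 1), (rho^-1 * (a2 + k * mu_min^-1 * e) + 1),
  (rho^-1 * a3 + 1).
move=> n n0 pi p rates A [mp plaw].
have mnu := measurable_nu_n (mu n).
have mA : measurable A.
  have := mnu measurableT _ (measurable_itv `]eps - varsigma_n n (lam n), +oo[).
  rewrite setTI; congr measurable; apply/seteqP; split=> w /=;
    by rewrite in_itv/= andbT ltrBlDl.
have mX i : measurable_fun A (fun w => law_mean (p (rates w)) (fun x => `|Xn i x| : R)).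
  apply: measurable_sum => x; apply: measurable_funM => //; exact: measurable_cst.
have bound i a c : 0 <= a -> 0 <= c ->
    (forall w, A w -> stationary_law pi (lam n) (rates w) (p (rates w)) ->
      law_mean (p (rates w)) (fun x => `|Xn i x|) <= a + c * `|nu_n (rates w)|) ->
    (stationary_cond_mean (P n) rates A p i <= (rho^-1 * (a + c * e))%:E)%E.
  move=> a0 c0 le; apply: (cond_expectation_le rho0 (rhoA n n0) a0 c0 mA (mX i) mnu _ (e_ge n)).
  apply: filterS plaw => w plw Aw; rewrite ger0_norm; first exact: le (plw Aw).
  exact: (mean_Xn_ge0 n0 (hlam _ n0) hmin (mu_bounds n w) (plw Aw)).
have X1 w :
    (varsigma_n n (lam n) + nu_n (rates w) + mu_min + mu_max) / mu_min <=
    a1 + mu_min^-1 * `|nu_n (rates w)|.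
  rewrite /a1 (mulrC mu_min^-1) -mulrDl ler_pM2r ?invr_gt0//.
  have := le_trans (ler_norm _) (S_ge n); have := ler_norm (nu_n (rates w)).
  by lra.
split.
- apply: lt_add1; apply: (bound 1%N a1 mu_min^-1) => // [|w Aw plw].
    by rewrite invr_ge0 ltW.
  apply: le_trans (X1 w).
  exact: (mean_X1_le n0 hb (hlam _ n0) hmin heps (mu_bounds n w) Aw plw).
- apply: lt_add1; apply: (bound 2%N a2 (k * mu_min^-1)) => // [|w Aw plw].
    by rewrite mulr_ge0// invr_ge0 ltW.
  apply: le_trans (mean_X2_le n0 hb (hlam _ n0) hmin heps (mu_bounds n w) Aw plw) _.
  set N := `|_|; have -> : a2 + k / mu_min * N = k * (a1 + mu_min^-1 * N + mu_max / eps).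
    by rewrite /a2; ring.
  by apply: ler_wpM2l => //; rewrite lerD2r; exact: X1.
- have s0 : 0 < Num.sqrt (n%:R : R) by rewrite sqrtr_gt0 ltr0n.
  (* The coefficient of [nu_n] is 0: the bound on the third coordinate is uniform in the slack. *)
  apply: (@le_lt_trans _ _ (rho^-1 * (a3 * (Num.sqrt n%:R)^-1 + 0 * e))%:E).
    apply: (bound 3%N) => // [|w Aw plw]; first by rewrite mulr_ge0// invr_ge0 ltW.
    rewrite mul0r addr0.
    exact: (mean_X3_le n0 hb (hlam _ n0) hmin heps (mu_bounds n w) Aw plw).
  rewrite lte_fin mul0r addr0 mulrA ltr_pM2r ?invr_gt0//.
  by rewrite ltrDl.
Qed.
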